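(* Let $r\ge 2$ be a fixed integer. Let $G$ be a simple $r$-graph with average degree $d$. Then, as $d\to\infty$, $$\chi_l(G)\ \ge\ (1+o(1))\,\frac{1}{(r-1)^2}\,\log_r d .$$ Moreover, if $G$ is regular then $$\chi_l(G)\ \ge\ (1+o(1))\,\frac{1}{r-1}\,\log_r d .$$ (Here $o(1)$ denotes a quantity tending to $0$ as $d\to\infty$ with $r$ fixed.)
   Context: An $r$-graph (an $r$-uniform hypergraph) $G$ is a pair $(V(G),E(G))$ where each edge $e\in E(G)$ is a set of $r$ elements of the finite vertex set $V(G)$. It is simple if every pair of vertices lies in at most one edge. The degree of a vertex is the number of edges containing it; $G$ is regular if all vertices have the same degree. $G$ is $k$-choosable if, whenever each vertex $v\in V(G)$ is assigned a list $L_v$ of $k$ colours, it is possible to choose for each $v$ a colour from $L_v$ so that no edge of $G$ has all its vertices of the same colour. The list chromatic number $\chi_l(G)$ is the smallest $k$ such that $G$ is $k$-choosable. *)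

(* Defs.v *)
From HB Require Import structures.
From mathcomp Require Import all_boot all_order all_algebra finmap.
From mathcomp Require Import all_classical all_reals all_analysis.

Set Implicit Arguments.
Unset Strict Implicit.
Unset Printing Implicit Defensive.

Import Order.TTheory GRing.Theory Num.Theory.
Local Open Scope ring_scope.

(* A hypergraph on the finite vertex set T is given by its edge set
   E : {set {set T}}. *)

Definition uniform_hypergraph (r : nat) (T : finType) (E : {set {set T}}) :=
  forall e : {set T}, e \in E -> #|e| = r.

Definition simple_hypergraph (T : finType) (E : {set {set T}}) :=
  forall x y : T, x != y ->
    (#|finset (fun e => [&& e \in E, x \in e & y \in e])| <= 1)%N.

Definition degree (T : finType) (E : {set {set T}}) (x : T) : nat :=
  #|finset (fun e => (e \in E) && (x \in e))|.

Definition regular_hypergraph (T : finType) (E : {set {set T}}) :=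
  forall x y : T, degree E x = degree E y.

Definition average_degree (R : realType) (T : finType) (E : {set {set T}}) : R :=
  (\sum_(x : T) degree E x)%N%:R / #|T|%:R.

Definition monochromatic (T : finType) (C : choiceType) (c : T -> C)
    (e : {set T}) :=
  forall x y : T, x \in e -> y \in e -> c x = c y.

Definition choosable (T : finType) (E : {set {set T}}) (k : nat) :=
  forall (C : choiceType) (L : T -> {fset C}),
    (forall v : T, #|` L v| = k) ->
    exists c : T -> C,
      (forall v : T, c v \in L v) /\
      (forall e : {set T}, e \in E -> ~ monochromatic c e).

(* The least k such that E is k-choosable. The default value 0 is returned only
   if no such k exists; this does not happen when every edge has at least two
   vertices, since one can then pick distinct colours from lists of size #|T|. *)
Definition list_chromatic_number (T : finType) (E : {set {set T}}) : nat :=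
  xget 0%N (fun k : nat =>
    choosable E k /\ forall j : nat, choosable E j -> (k <= j)%N).

Definition log_base (R : realType) (b : nat) (x : R) : R := ln x / ln b%:R.

(* Main.v *)
Require Import Defs.
From mathcomp Require Import all_boot all_order all_algebra zify ring lra.

Set Implicit Arguments.
Unset Strict Implicit.
Unset Printing Implicit Defensive.

(** The argument is that of Saxton and Thomason. Scan the vertices in order. For
    an independent set [I], a vertex of [I] that is the first vertex of many
    edges is put in the fingerprint [T], and the tails of these edges form an
    [(r-1)]-graph that is still independent of [I]; no further edges are added at a
    vertex whose degree in it has reached [1/q] of its previous capacity. After
    [r-1] such rounds, the vertices that carry a one-element edge cannot lie in
    [I], nor can the vertices that passed a degree test without belonging to [T].
    The other vertices form a container of [I], determined by [T], and the part of
    it on an initial segment is determined by the part of [T] there. With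
    [q^(r-1)] of the order of the degree [d], the fingerprint has degree measure
    [O(1/q)], and the complement of the container has degree measure about
    [r^-(r-1)]. In a regular hypergraph, iterating inside the container raises
    this to about [1/r].

    Give every vertex a random list of [k] colours out of a palette of [O(k)]. If
    a proper colouring exists, its colour classes have fingerprints for which no
    vertex has all its colours outside their containers; for given fingerprints
    a fraction [c^k] of the lists is bad at a constant proportion of the vertices,
    where [c] is close to [r^-(r-1)], respectively [1/r]. A union bound over the
    fingerprints fails to be below [1] only if [c^k] is at most about [1/q]. When
    degrees vary, the union bound is taken over initial segments of the vertices
    in decreasing order of degree: summation by parts gives a segment that has
    few fingerprint vertices and many vertices with bad lists. *)

(** * Online containers *)

Definition linear_edges (T : finType) (H : {set {set T}}) :=
  forall e e' x y, e \in H -> e' \in H -> x != y ->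
    x \in e -> y \in e -> x \in e' -> y \in e' -> e = e'.

Definition independent (T : finType) (H : {set {set T}}) (I : {set T}) :=
  forall e, e \in H -> ~~ (e \subset I).

Lemma simple_linear (T : finType) (H : {set {set T}}) :
  simple_hypergraph H -> linear_edges H.
Proof.
move=> sH e e' x y eH e'H xy xe ye xe' ye'.
have /card_le1_eqP le1 := sH x y xy.
by apply: le1; rewrite inE ?eH ?e'H ?xe ?xe' ?ye ?ye'.
Qed.

Lemma degree_sum (T : finType) (H : {set {set T}}) (x : T) :
  degree H x = \sum_(e in H) (x \in e).
Proof.
rewrite /degree -sum1_card big_mkcond [RHS]big_mkcond /=.
by apply: eq_bigr => e _; rewrite inE; do 2!case: (_ \in _).
Qed.

Lemma degree_subset (T : finType) (H H' : {set {set T}}) (x : T) :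
  H \subset H' -> degree H x <= degree H' x.
Proof.
move=> sHH'; apply: subset_leq_card; apply/subsetP => e.
by rewrite !inE => /andP[/(subsetP sHH')-> ->].
Qed.

Lemma sum_degree (T : finType) (H : {set {set T}}) (s : nat) :
  uniform_hypergraph s H -> \sum_x degree H x = s * #|H|.
Proof.
move=> uH; under eq_bigr do rewrite degree_sum.
rewrite exchange_big /= -sum1_card big_distrr /=; apply: eq_bigr => e eH.
by rewrite muln1 -(uH e eH) -sum1_card [RHS]big_mkcond.
Qed.

Lemma card_meeting (T : finType) (H K : {set {set T}}) (A : {set T}) :
  K \subset H -> (forall e, e \in K -> exists2 u, u \in e & u \in A) ->
  #|K| <= \sum_(u in A) degree H u.
Proof.
move=> sKH meets; under eq_bigr do rewrite degree_sum.
rewrite exchange_big /= -sum1_card big_mkcond [leqRHS]big_mkcond /=.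
apply: leq_sum => e _; case: ifP => // eK; rewrite (subsetP sKH _ eK).
by have [u ue uA] := meets e eK; rewrite (bigD1 u) //= ue.
Qed.

Section Head.
Variable n : nat.
Implicit Types (e : {set 'I_n}) (i j : 'I_n).

Definition is_head i e := (i \in e) && [forall u in e, i <= u].

Lemma is_headP i e : reflect (i \in e /\ forall u, u \in e -> i <= u) (is_head i e).
Proof.
apply: (iffP andP) => -[ie le]; split=> //; last by apply/forall_inP.
by move/forall_inP: le.
Qed.

Lemma is_head_inj i j e : is_head i e -> is_head j e -> i = j.
Proof.
move=> /is_headP[ie li] /is_headP[je lj]; apply/val_inj/anti_leq.
by rewrite li // lj.
Qed.

Lemma has_head e : 0 < #|e| -> exists i, is_head i e.
Proof.
case/card_gt0P=> x xe; have [i ie le] := arg_minnP (@nat_of_ord n) xe.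
by exists i; apply/is_headP.
Qed.

End Head.

(** * One pass of the algorithm over the vertices *)

Section Step.
Variables (n m : nat) (cap thr : 'I_n -> nat).
Implicit Types (H F : {set {set 'I_n}}) (S : {set 'I_n}) (i : 'I_n).

(** The edges whose tails may still be recorded when the scan reaches [i]: no vertex of the tail is
    saturated in the graph [F] built so far. *)
Definition useful H F i : {set {set 'I_n}} :=
  [set e in H | is_head i e & [forall u in e :\ i, degree F u < cap u]].

Definition active H F i := thr i <= m * #|useful H F i|.

Definition add_tails H S F i :=
  if (i \in S) && active H F i then F :|: [set e :\ i | e in useful H F i]
  else F.

(** The state just before vertex [k] is visited. [insub] turns the counter into a vertex; counters
    past the last vertex change nothing. *)
Fixpoint scan H S (k : nat) : {set {set 'I_n}} :=
  if k is k'.+1 then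
    if insub k' is Some i then add_tails H S (scan H S k') i else scan H S k'
  else set0.

(** Activity of [i] is decided before [S] is consulted at [i], so an active vertex missing from the
    fingerprint is known to lie outside [S]. *)
Definition active_set H S := [set i : 'I_n | active H (scan H S i) i].

Lemma scanS H S i : scan H S i.+1 = add_tails H S (scan H S i) i.
Proof. by rewrite /= valK. Qed.

Lemma scan_ind (P : nat -> Prop) :
  P 0 -> (forall i : 'I_n, P i -> P i.+1) -> forall k, k <= n -> P k.
Proof.
move=> P0 PS; elim=> // k IHk ltkn.
exact: (PS (Ordinal ltkn) (IHk (ltnW ltkn))).
Qed.

Lemma scan_mono H S k k' : k <= k' -> scan H S k \subset scan H S k'.
Proof.
move=> /subnK <-; elim: (k' - k) => //= l; case: insubP => // i _ _.
move/subset_trans; apply; rewrite /add_tails; case: ifP => // _.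
exact: subsetUl.
Qed.

Lemma scanP H S k (f : {set 'I_n}) : k <= n ->
  reflect (exists (i : 'I_n) e, [/\ i < k, i \in S, i \in active_set H S,
                          e \in useful H (scan H S i) i & f = e :\ i])
          (f \in scan H S k).
Proof.
move=> lekn; apply: (iffP idP).
  move: k lekn f; apply: scan_ind => [f|i IH f]; first by rewrite inE.
  have lift : f \in scan H S i -> exists (j : 'I_n) e, [/\ j < i.+1, j \in S,
      j \in active_set H S, e \in useful H (scan H S j) j & f = e :\ j].
    by move=> /IH[j [e [ltji *]]]; exists j, e; split=> //; apply: ltnW.
  rewrite scanS /add_tails; case: ifP => // /andP[iS iact].
  rewrite inE => /orP[/lift //|/imsetP[e eu ->]].
  by exists i, e; rewrite inE ltnSn.
case=> i [e [ltik iS iact eu ->]].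
apply: (subsetP (scan_mono H S ltik)); rewrite scanS /add_tails iS /=.
by move: iact; rewrite inE => ->; apply/setUP; right; apply/imsetP; exists e.
Qed.

Lemma usefulP H F i e : reflect
  [/\ e \in H, is_head i e & forall u, u \in e -> u != i -> degree F u < cap u]
  (e \in useful H F i).
Proof.
rewrite inE; apply: (iffP and3P) => -[eH he].
  by move/forall_inP=> lt; split=> // u ue ui; apply: lt; rewrite !inE ui.
move=> lt; split=> //; apply/forall_inP => u; rewrite !inE => /andP[ui ue].
exact: lt.
Qed.

Lemma useful_agree H H' F i : (forall e, is_head i e -> (e \in H) = (e \in H')) ->
  useful H F i = useful H' F i.
Proof.
move=> HH'; apply/setP => e; rewrite !inE.
by case he: (is_head i e); rewrite ?andbF // HH'.
Qed.

(** Onlineness of a pass: the state before [k] depends only on the edges headed before [k] and on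
    the part of [S] before [k]. *)
Lemma scan_agree H H' S S' k : k <= n ->
  (forall (i : 'I_n) e, i < k -> is_head i e -> (e \in H) = (e \in H')) ->
  (forall i : 'I_n, i < k -> (i \in S) = (i \in S')) ->
  scan H S k = scan H' S' k.
Proof.
move: k; apply: scan_ind => // i IH HH' SS'.
rewrite !scanS IH; first last.
- by move=> j lt; apply: SS'; apply: ltnW.
- by move=> j e lt; apply: HH'; apply: ltnW.
rewrite /add_tails SS' // /active (@useful_agree H H') // => e.
exact: HH'.
Qed.

Lemma active_set_agree H H' S S' i :
  (forall (j : 'I_n) e, j <= i -> is_head j e -> (e \in H) = (e \in H')) ->
  (forall j : 'I_n, j < i -> (j \in S) = (j \in S')) ->
  (i \in active_set H S) = (i \in active_set H' S').
Proof.
move=> HH' SS'; rewrite !inE (@scan_agree H H' S S') //; last 2 first.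
- exact: ltnW.
- by move=> j e /ltnW; apply: HH'.
by rewrite /active (@useful_agree H H') // => e; apply: HH'.
Qed.

(** [S] influences the scan only at active vertices, so the scan can be replayed from the
    fingerprint alone. *)
Lemma scan_sandwich H S S' : S :&: active_set H S \subset S' -> S' \subset S ->
  forall k, k <= n -> scan H S' k = scan H S k.
Proof.
move=> sub1 sub2; apply: scan_ind => // i IH.
rewrite !scanS IH /add_tails.
case iS': (i \in S'); first by rewrite (subsetP sub2 _ iS').
case: ifP => //= /andP[iS iact].
suff : i \in S' by rewrite iS'.
by apply: (subsetP sub1); rewrite !inE iS.
Qed.

Lemma active_set_sandwich H S S' :
  S :&: active_set H S \subset S' -> S' \subset S ->
  active_set H S' = active_set H S.
Proof.
move=> sub1 sub2; apply/setP => i; rewrite !inE.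
by rewrite (scan_sandwich sub1 sub2) // ltnW.
Qed.

Lemma active_in_cover H S i : 0 < thr i -> i \in active_set H S -> i \in cover H.
Proof.
move=> thr0; rewrite inE /active => /(leq_trans thr0).
rewrite muln_gt0 => /andP[_ /card_gt0P[e /usefulP[eH /is_headP[ie _] _]]].
by apply/bigcupP; exists e.
Qed.

Lemma scan_cover H S k : k <= n -> cover (scan H S k) \subset cover H.
Proof.
move=> lekn; apply/bigcupsP => f /(scanP _ _ _ lekn)[i [e [_ _ _ /usefulP[eH _ _] ->]]].
exact: subset_trans (subD1set _ _) (bigcup_sup e eH).
Qed.

Lemma scan_independent H S :
  independent H S -> independent (scan H S n) S.
Proof.
move=> indH f /(scanP _ _ _ (leqnn n))[i [e [_ iS _ /usefulP[eH _ _] ->]]].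
apply: contra (indH e eH); rewrite subDset => /subset_trans; apply.
by rewrite subUset subxx sub1set iS.
Qed.

Section Bounds.
Variables (s : nat) (H : {set {set 'I_n}}) (S : {set 'I_n}).
Hypotheses (uH : uniform_hypergraph s.+2 H) (linH : linear_edges H).

Lemma scan_uniform k : k <= n -> uniform_hypergraph s.+1 (scan H S k).
Proof.
move=> lekn f /(scanP _ _ _ lekn)[i [e [_ _ _ /usefulP[eH /is_headP[ie _] _] ->]]].
by have := uH eH; rewrite (cardsD1 i) ie add1n => -[].
Qed.

Lemma scan_linear k : k <= n -> linear_edges (scan H S k).
Proof.
move=> lekn f f' x y /(scanP _ _ _ lekn)[i [e [_ _ _ /usefulP[eH hi _] ->]]].
move=> /(scanP _ _ _ lekn)[i' [e' [_ _ _ /usefulP[e'H hi' _] ->]]] xy.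
rewrite !inE => /andP[_ xe] /andP[_ ye] /andP[_ xe'] /andP[_ ye'].
have ee' := linH eH e'H xy xe ye xe' ye'.
by rewrite -ee' in hi' *; rewrite (is_head_inj hi hi').
Qed.

(** By linearity at most one edge contains both [u] and the current head, so a visit raises the
    degree of [u] by at most one, and only while it is below the capacity. *)
Lemma scan_degree k u : k <= n -> degree (scan H S k) u <= cap u.
Proof.
move: k; apply: scan_ind => [|i IH].
  by rewrite degree_sum big_set0.
rewrite scanS /add_tails; case: ifP => // _.
set F := scan H S i in IH *.
case: (boolP [exists e in useful H F i, u \in e :\ i]); last first.
  move/exists_inPn => none; apply: leq_trans IH; apply: subset_leq_card.
  apply/subsetP => f; rewrite !inE => /andP[/orP[-> //|/imsetP[e eu ->]]].
  by rewrite (negbTE (none e eu)).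
case/exists_inP=> e eu uei; move/usefulP: (eu) => [eH /is_headP[ie _] ltcap].
move: (uei); rewrite !inE => /andP[ui ue].
apply: leq_trans (ltcap u ue ui); rewrite /degree.
set A := finset _; set A' := finset _.
have -> : A = A' :|: (A :\: A').
  by apply/setP => f; rewrite !inE; do 3!case: (_ \in _).
apply: leq_trans (leq_card_setU _ _) _; rewrite -addn1 leq_add2l.
apply: leq_trans (_ : #|[set e :\ i]| <= 1); last by rewrite cards1.
apply: subset_leq_card; apply/subsetP => f /setDP[].
rewrite !inE => /andP[/orP[->|/imsetP[e' /usefulP[e'H /is_headP[ie' _] _] ->]]].
  by move=> ->.
rewrite !inE => /andP[_ ue'] _.
by rewrite (linH eH e'H ui ue ie ue' ie').
Qed.

(* Distinct linear edges have distinct tails, except that singleton tails may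
   coincide; this is prevented by taking capacities equal to 1. *)
Lemma card_scan (cap1 : s = 0 -> forall u, cap u <= 1) k : k <= n ->
  \sum_(i in S :&: active_set H S | i < k) thr i <= m * #|scan H S k|.
Proof.
move: k; apply: scan_ind => [|i IH]; first by rewrite big1 // => j; rewrite andbF.
rewrite scanS; rewrite (bigID (fun j => j == i)) /= addnC.
rewrite (eq_bigl (fun j => (j \in S :&: active_set H S) && (j < i))); last first.
  by move=> j; rewrite -andbA ltnS [(j < i)%N]ltn_neqAle [(j != i) && _]andbC.
rewrite /add_tails; case: ifP => [iSact|niact]; last first.
  rewrite [X in _ + X]big1 ?addn0 // => j /andP[/andP[jSA _] /eqP ji]; move: jSA; rewrite ji.
  by rewrite !inE niact.
case/andP: iSact => iS iact; set F := scan H S i in IH iact *.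
have tail_inj : {in useful H F i &, injective (fun e => e :\ i)}.
  move=> e e' /usefulP[_ /is_headP[ie _] _] /usefulP[_ /is_headP[ie' _] _] ee'.
  by rewrite -(setD1K ie) -(setD1K ie') ee'.
rewrite cardsU [F :&: _]disjoint_setI0; last first.
  rewrite disjoint_subset; apply/subsetP => f fF; rewrite inE; apply/negP => /imsetP[e eu fe].
  move/usefulP: eu => [eH hi ltcap].
  have ie : i \in e by case/is_headP: hi.
  have cf : #|f| = s.+1.
    by have := uH eH; rewrite (cardsD1 i) ie add1n -fe => -[].
  have sfe : f \subset e by rewrite fe subD1set.
  have fF' := fF; have /(scanP _ _ _ (ltnW (ltn_ord i)))[j [e' [ltji _ _ ]]] := fF.
  move=> /usefulP[e'H hj _] fe'.
  have sfe' : f \subset e' by rewrite fe' subD1set.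
  have [s0|s0] := posnP s.
    have [u fu] : exists u, f = [set u] by apply/cards1P; rewrite cf s0.
    have uf : u \in f by rewrite fu set11.
    have ui : u != i by move: uf; rewrite fe !inE => /andP[].
    have := ltcap u (subsetP sfe _ uf) ui.
    move/leq_trans/(_ (cap1 s0 u)); rewrite ltnS leqn0 cards_eq0.
    by move/eqP/setP/(_ f); rewrite !inE fF uf.
  have /card_gt1P[x [y [xf yf xy]]] : 1 < #|f| by rewrite cf.
  have ee' : e = e' by apply: (linH eH e'H xy); apply: (subsetP _ _ _); eassumption.
  by move: hj; rewrite -ee' => /(is_head_inj hi) ij; rewrite ij ltnn in ltji.
rewrite cards0 subn0 card_in_imset // mulnDr leq_add //.
apply: leq_trans (iact); rewrite (big_pred1 i) // => j /=.
case: eqVneq => [->|]; rewrite ?andbF // andbT ltnSn andbT !inE iS.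
exact: iact.
Qed.

End Bounds.
End Step.

Lemma leq_sum_subset (T : finType) (A B : {set T}) (f : T -> nat) :
  A \subset B -> \sum_(u in A) f u <= \sum_(u in B) f u.
Proof.
move=> sAB; rewrite [leqRHS](big_setID A) /=.
by rewrite (setIidPr sAB) leq_addr.
Qed.

Lemma leq_sum_setU (T : finType) (A B : {set T}) (f : T -> nat) :
  \sum_(v in A :|: B) f v <= \sum_(v in A) f v + \sum_(v in B) f v.
Proof.
rewrite big_mkcond [X in _ <= X + _]big_mkcond [X in _ <= _ + X]big_mkcond.
rewrite -big_split; apply: leq_sum => v _ /=.
by rewrite in_setU; case: (v \in A); case: (v \in B); rewrite /= ?leq_addr ?leq_addl.
Qed.

Lemma step_arith (q Q m s y f l Z : nat) : Q * y <= s * f -> m * f <= l * Q * Z ->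
  q * Q * (Z + m * y) <= (s * l + 1) * (q * Q * Z).
Proof.
move=> /(leq_mul (leqnn (q * m))) leY /(leq_mul (leqnn (q * s))) leF.
have -> : q * Q * (Z + m * y) = q * Q * Z + q * m * (Q * y) by ring.
have -> : (s * l + 1) * (q * Q * Z) = q * Q * Z + q * s * (l * Q * Z) by ring.
rewrite leq_add2l; apply: leq_trans leY _; apply: leq_trans leF.
by have -> : q * m * (s * f) = q * s * (m * f) by ring.
Qed.

(** * Iterating the pass down to one-element edges *)

Section Container.
Variables (n m q : nat) (b : 'I_n -> nat).
Hypotheses (q_gt0 : 0 < q) (b_gt0 : forall u, 0 < b u).
Implicit Types (H : {set {set 'I_n}}) (S : {set 'I_n}).

(** Each pass lowers the degree scale by a factor [q]. At uniformity one the capacity is exactly 1,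
    since a one-element edge can be recorded only once. *)
Definition capacity s (u : 'I_n) := if s is 0 then 1 else b u * q ^ s.

Definition threshold s (u : 'I_n) := b u * q ^ s.+1.

Definition next s H S := scan m (capacity s) (threshold s) H S n.

Definition selected s H S := active_set m (capacity s) (threshold s) H S.

(* For an [s.+1]-uniform [H]: [sel] are the vertices that the algorithm adds to
   the fingerprint if they belong to [S], and [excl] the complement of the
   container. *)
Fixpoint sel s H S : {set 'I_n} :=
  if s is s'.+1 then selected s' H S :|: sel s' (next s' H S) S else set0.

Fixpoint excl s H S : {set 'I_n} :=
  if s is s'.+1 then selected s' H S :|: excl s' (next s' H S) S else cover H.

Let thr_gt0 s u : 0 < threshold s u.
Proof. by rewrite muln_gt0 b_gt0 expn_gt0 q_gt0. Qed.

Lemma capacity_le s u : capacity s u <= b u * q ^ s.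
Proof. by case: s => //=; rewrite expn0 muln1. Qed.

Lemma excl_cover s H S : excl s H S \subset cover H.
Proof.
elim: s H => [|s IH] H //=.
rewrite subUset (subset_trans (IH _)) ?scan_cover // andbT.
by apply/subsetP => i; apply: active_in_cover.
Qed.

Lemma next_uniform s H S : uniform_hypergraph s.+2 H ->
  uniform_hypergraph s.+1 (next s H S).
Proof. by move=> uH; apply: scan_uniform. Qed.

Lemma next_linear s H S : linear_edges H -> linear_edges (next s H S).
Proof. by move=> linH; apply: scan_linear. Qed.

Lemma next_degree s H S u : linear_edges H -> degree (next s H S) u <= capacity s u.
Proof. by move=> linH; apply: scan_degree. Qed.

(** Every graph produced by the passes is still independent of [S], so a vertex carrying a
    one-element edge is not in [S]; the other excluded vertices are active and hence in [sel]. *)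
Lemma excl_independent s H S : uniform_hypergraph s.+1 H -> independent H S ->
  S :&: excl s H S \subset sel s H S.
Proof.
elim: s H => [|s IH] H uH indS /=.
  apply/subsetP => v; rewrite inE => /andP[vS /bigcupP[e eH ve]].
  have /cards1P[u eu] : #|e| == 1 by rewrite (uH e eH).
  move: ve (indS e eH); rewrite eu inE => /eqP <-.
  by rewrite sub1set vS.
rewrite setIUr subUset (subset_trans (subsetIr _ _) (subsetUl _ _)) /=.
apply: subset_trans (subsetUr _ _); apply: IH; first exact: next_uniform.
exact: scan_independent.
Qed.

Lemma sel_sandwich s H S S' : S :&: sel s H S \subset S' -> S' \subset S ->
  sel s H S' = sel s H S /\ excl s H S' = excl s H S.
Proof.
move=> + sub2; elim: s H => //= s IH H.
rewrite setIUr subUset => /andP[sub1 /IH[sE eE]].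
rewrite /next /selected (scan_sandwich sub1 sub2) // -/(next s H S).
by rewrite (active_set_sandwich sub1 sub2) sE eE.
Qed.

(** Onlineness survives iteration because a recorded tail is headed strictly after the vertex that
    recorded it. *)
Lemma excl_agree s H H' S S' (w : nat) :
  (forall (j : 'I_n) e, j <= w -> is_head j e -> (e \in H) = (e \in H')) ->
  (forall j : 'I_n, j < w -> (j \in S) = (j \in S')) ->
  uniform_hypergraph s.+1 H -> uniform_hypergraph s.+1 H' ->
  forall v : 'I_n, v <= w -> (v \in excl s H S) = (v \in excl s H' S').
Proof.
elim: s H H' => [|s IH] H H' HH' SS' uH uH' v lev /=.
  have cover1 K : uniform_hypergraph 1 K -> (v \in cover K) = ([set v] \in K).
    move=> uK; apply/bigcupP/idP => [[e eK ve]|]; last by exists [set v]; rewrite ?set11.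
    have /cards1P[u eu] : #|e| == 1 by rewrite (uK e eK).
    by move: ve eK; rewrite eu inE => /eqP <-.
  rewrite !cover1 // (HH' v) //; apply/is_headP; split; first exact: set11.
  by move=> u; rewrite inE => /eqP->.
rewrite !in_setU; congr (_ || _).
  apply: active_set_agree => [j e lej|j ltj].
    by apply: HH'; apply: leq_trans lev.
  by apply: SS'; apply: leq_trans lev.
apply: IH => //; try exact: next_uniform.
move=> j f lejw hj.
(* A tail headed at [j] was recorded at a vertex before [j], hence is already present in the state
   before [j]. *)
have restrict K P : (f \in next s K P) =
    (f \in scan m (capacity s) (threshold s) K P j).
  apply/idP/idP; last exact/subsetP/scan_mono/ltnW.
  move=> /(scanP _ _ _ _ _ _ (leqnn n))[i [e [_ iP iact eu fe]]].
  apply/(scanP _ _ _ _ _ _ (ltnW (ltn_ord j))); exists i, e; split=> //.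
  move/usefulP: eu => [_ /is_headP[_ lei] _].
  move/is_headP: hj => [jf _]; move: jf; rewrite fe !inE => /andP[ji /lei].
  by rewrite [i <= j]leq_eqVlt => /orP[/eqP/val_inj ij|//]; rewrite ij eqxx in ji.
rewrite !restrict.
rewrite (@scan_agree _ _ _ _ H H' S S') // => [|i e ltij|i ltij].
- exact: ltnW.
- by apply: HH'; apply: leq_trans (ltnW ltij) lejw.
- by apply: SS'; apply: leq_trans ltij lejw.
Qed.

(** In a pass, each fingerprint vertex [v] contributes at least [b v * q ^ s.+1 / m] tails, while
    the capacities allow at most [q ^ s] times the total weight. So a pass adds weight at most
    [m / q] of the total. *)
Lemma sel_weight s H S : uniform_hypergraph s.+1 H -> linear_edges H ->
  q * \sum_(v in S :&: sel s H S) b v <= s * m * \sum_v b v.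
Proof.
elim: s H => [|s IH] H uH linH /=; first by rewrite setI0 big_set0 muln0.
rewrite setIUr; set A := S :&: _; set A' := S :&: _; set B := \sum_v b v.
apply: leq_trans (leq_mul (leqnn q) (leq_sum_setU A A' b)) _; rewrite mulnDr.
rewrite mulSn mulnDl leq_add ?IH //; [|exact: next_uniform|exact: next_linear].
have cap1 : s = 0 -> forall u, capacity s u <= 1 by move=> ->.
have := @card_scan n m (capacity s) (threshold s) s H S uH linH cap1 n (leqnn n).
rewrite -/(next s H S) -/A => leT.
have leF : #|next s H S| <= B * q ^ s.
  apply: leq_trans (_ : s.+1 * #|next s H S| <= _); first exact: leq_pmull.
  rewrite -(sum_degree (next_uniform uH)) /B big_distrl; apply: leq_sum => u _.
  exact: leq_trans (next_degree _ _ _ linH) (capacity_le _ _).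
rewrite -(@leq_pmul2r (q ^ s)) ?expn_gt0 ?q_gt0 // mulnAC -expnS.
apply: leq_trans (_ : _ <= m * #|next s H S|) _; last first.
  by rewrite -mulnA leq_mul2l leF orbT.
apply: leq_trans leT; rewrite big_distrr /= [leqRHS](eq_bigl (fun v => v \in A)).
  by apply: leq_sum => v _; rewrite mulnC.
by move=> v; rewrite ltn_ord andbT.
Qed.

Fixpoint loss s := if s is s'.+1 then s * loss s' + 1 else 0.

Lemma loss_le s : loss s.+1 <= s.+2 ^ s.
Proof.
elim: s => // s IH; rewrite [loss _]/= -/(loss s.+1).
apply: leq_trans (_ : s.+2 ^ s.+1 + 1 <= _).
  by rewrite leq_add2r expnS leq_mul.
by rewrite addn1 ltn_exp2r.
Qed.

(** Three kinds of edges: those meeting the excluded set [X]; those useful when their head is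
    scanned, which are few because a head outside [X] is inactive; and those rejected because of a
    saturated vertex, which lies in [X] or in the last set. *)
Lemma card_step s H S (X := excl s.+1 H S) : uniform_hypergraph s.+2 H ->
  linear_edges H -> (forall u, degree H u <= b u * q ^ s.+1) ->
  m * #|H| <= q ^ s.+1 * (m * \sum_(u in X) b u + \sum_u b u
    + m * \sum_(u in [set u in ~: X | capacity s u <= degree (next s H S) u]) b u).
Proof.
move=> uH linH degH; set Y := [set u in ~: X | _].
pose F i := scan m (capacity s) (threshold s) H S i.
pose K1 := [set e in H | [exists u in e, u \in X]].
pose K2 := \bigcup_(v in ~: X) useful (capacity s) H (F v) v.
pose K3 := [set e in H | [exists u in e, u \in Y]].
have sub : H \subset K1 :|: K2 :|: K3.
  apply/subsetP => e eH; rewrite !in_setU -orbA.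
  have [i hi] : exists i, is_head i e by apply: has_head; rewrite (uH e eH).
  have ie : i \in e by case/is_headP: hi.
  case: (boolP (e \in K1)) => //=; rewrite inE eH /= => /exists_inPn avoid.
  case: (boolP (e \in useful (capacity s) H (F i) i)) => [eu|].
    by apply/orP; left; apply/bigcupP; exists i; rewrite // in_setC avoid.
  move=> neu; apply/orP; right; rewrite inE eH /=.
  move: neu; rewrite inE eH hi /= => /forall_inPn[u]; rewrite !inE => /andP[ui ue].
  rewrite -leqNgt => lecap; apply/exists_inP; exists u; rewrite // in_set in_setC avoid //=.
  apply: leq_trans lecap _; apply: degree_subset; apply: scan_mono.
  exact: ltnW.
have meet (A : {set 'I_n}) :
    #|[set e in H | [exists u in e, u \in A]]| <= q ^ s.+1 * \sum_(u in A) b u.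
  apply: leq_trans (_ : \sum_(u in A) degree H u <= _).
    apply: card_meeting; first by apply/subsetP => e; rewrite inE => /andP[].
    by move=> e; rewrite inE => /andP[_ /exists_inP].
  by rewrite big_distrr /=; apply: leq_sum => u _; rewrite mulnC.
have leK2 : m * #|K2| <= q ^ s.+1 * \sum_u b u.
  apply: leq_trans (_ : \sum_(v in ~: X) m * #|useful (capacity s) H (F v) v| <= _).
    rewrite -big_distrr leq_mul2l; apply/orP; right.
    rewrite /K2; elim/big_rec2: _ => [|v c A _ le]; first by rewrite cards0.
    exact: leq_trans (leq_card_setU _ _) (leq_add (leqnn _) le).
  rewrite big_distrr [leqRHS](bigID (fun v => v \in ~: X)) /=.
  apply: leq_trans (leq_addr _ _); apply: leq_sum => v.
  rewrite in_setC /X [excl _ _ _]/= in_setU negb_or => /andP[+ _].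
  by rewrite inE -ltnNge [leqRHS]mulnC; apply: ltnW.
apply: leq_trans (_ : m * (#|K1| + #|K2| + #|K3|) <= _).
  rewrite leq_mul2l (leq_trans (subset_leq_card sub)) ?orbT //.
  apply: leq_trans (leq_card_setU _ _) _; rewrite leq_add2r.
  exact: leq_card_setU.
rewrite !mulnDr !leq_add // mulnCA leq_mul2l; apply/orP; right; exact: meet.
Qed.

(** A large excluded set is forced by counting edges: saturated vertices outside it have large
    degree in the next graph, whose size is bounded by induction. This gives the recursion of
    [loss]. *)
Lemma card_le_excl s H S : uniform_hypergraph s.+2 H -> linear_edges H ->
  (forall u, degree H u <= b u * q ^ s.+1) ->
  m * #|H| <= loss s.+1 * q ^ s.+1 *
    (m * \sum_(u in excl s.+1 H S) b u + \sum_u b u).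
Proof.
elim: s H => [|s IH] H uH linH degH;
  apply: leq_trans (card_step S uH linH degH) _; rewrite -[leqRHS]mulnA.
  (* The next graph has one-element edges, and every vertex carrying one is excluded, so no vertex
     outside the excluded set is saturated. *)
  set Y := [set u in _ | _]; suff -> : Y = set0.
    have -> : loss 1 = 1 by []; by rewrite big_set0 muln0 addn0 mul1n.
  apply/setP => u; rewrite !inE /=; apply/negP => /andP[/norP[_ /negP]].
  move=> ncov; rewrite card_gt0 => /set0Pn[f]; rewrite inE => /andP[fF uf].
  by apply: ncov; apply/bigcupP; exists f.
set M := \sum_(u in _) _; set B := \sum_u _.
set Y := [set u in _ | _]; set F := next s.+1 H S in Y *.
have uF : uniform_hypergraph s.+2 F by apply: next_uniform.
have leF := IH F uF (@next_linear s.+1 H S linH) (fun u => next_degree s.+1 S u linH).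
have leM : \sum_(u in excl s.+1 F S) b u <= M.
  exact: leq_sum_subset (subsetUr _ _).
have leY : q ^ s.+1 * \sum_(u in Y) b u <= s.+2 * #|F|.
  rewrite -(sum_degree uF) big_distrr [leqRHS](bigID (fun v => v \in Y)) /=.
  apply: leq_trans (leq_addr _ _); apply: leq_sum => v.
  by rewrite !inE => /andP[_]; rewrite mulnC.
have {}leF : m * #|F| <= loss s.+1 * q ^ s.+1 * (m * M + B).
  by apply: leq_trans leF _; rewrite leq_mul2l leq_add2r leq_mul2l leM !orbT.
set y := \sum_(u in Y) b u in leY *; set Z := m * M + B in leF *.
have -> : loss s.+2 = s.+2 * loss s.+1 + 1 by [].
move: (loss _) (#|F|) leF leY => l f leF leY.
by rewrite expnS; apply: step_arith leY leF.
Qed.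

End Container.

(** * Repeated rounds inside the container *)

Definition induced (T : finType) (E : {set {set T}}) (C : {set T}) :=
  [set e in E | e \subset C].

Section Rounds.
Variables (n m q s : nat) (b : 'I_n -> nat) (E : {set {set 'I_n}}).
Hypotheses (q_gt0 : 0 < q) (b_gt0 : forall u, 0 < b u).
Hypotheses (uE : uniform_hypergraph s.+1 E) (linE : linear_edges E).
Implicit Types (S C : {set 'I_n}).

Fixpoint residue l S : {set 'I_n} :=
  if l is l'.+1 then
    residue l' S :\: excl m q b s (induced E (residue l' S)) S
  else setT.

Fixpoint round_sel l S : {set 'I_n} :=
  if l is l'.+1 then
    round_sel l' S :|: sel m q b s (induced E (residue l' S)) S
  else set0.

Lemma induced_uniform C : uniform_hypergraph s.+1 (induced E C).
Proof. by move=> e; rewrite inE => /andP[/uE]. Qed.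

Lemma induced_linear C : linear_edges (induced E C).
Proof.
by move=> e e' x y; rewrite !inE => /andP[eE _] /andP[e'E _]; apply: linE.
Qed.

Lemma round_excl l S : independent E S -> S :\: residue l S \subset round_sel l S.
Proof.
move=> indS; elim: l => [|l IH] /=; first by rewrite setDT sub0set.
rewrite setDDr subUset (subset_trans IH (subsetUl _ _)) /=.
apply: subset_trans (subsetUr _ _); apply: excl_independent => //.
  exact: induced_uniform.
by move=> e; rewrite inE => /andP[/indS].
Qed.

Lemma round_sandwich l S S' : S :&: round_sel l S \subset S' -> S' \subset S ->
  residue l S' = residue l S.
Proof.
move=> + sub2; elim: l => //= l IH.
rewrite setIUr subUset => /andP[/IH -> sub].
by have [_ ->] := sel_sandwich sub sub2.
Qed.

Lemma round_weight l S :
  q * \sum_(v in S :&: round_sel l S) b v <= l * (s * m) * \sum_v b v.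
Proof.
elim: l => [|l IH] /=; first by rewrite setI0 big_set0 muln0.
rewrite setIUr; apply: leq_trans (leq_mul (leqnn q) (leq_sum_setU _ _ _)) _.
rewrite mulnDr mulSn addnC mulnDl leq_add // sel_weight //.
  exact: induced_uniform.
exact: induced_linear.
Qed.

Lemma residue_mono k l S : k <= l -> residue l S \subset residue k S.
Proof.
move=> /subnK <-; elim: (l - k) => //= j; apply: subset_trans; exact: subsetDl.
Qed.

Lemma excl_residue l S :
  excl m q b s (induced E (residue l S)) S = residue l S :\: residue l.+1 S.
Proof.
rewrite /= setDDr setDv set0U; apply/esym/setIidPr.
apply: subset_trans (excl_cover _ _ _ _ _ _) _ => //.
by apply/bigcupsP => e; rewrite inE => /andP[].
Qed.

End Rounds.

(** The vertices removed in [m] rounds number at most [n], so some round removes at most [n / m] of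
    them. For that round [card_le_excl] shows that few edges lie inside the residue, and later
    residues are smaller. *)
Lemma card_residue (n m q s b0 d : nat) (E : {set {set 'I_n}}) (S : {set 'I_n}) :
  0 < q -> 0 < b0 -> 0 < m -> uniform_hypergraph s.+2 E -> linear_edges E ->
  (forall u, degree E u = d) -> d <= b0 * q ^ s.+1 ->
  m * #|induced E (residue m q s.+1 (fun=> b0) E m S)| <=
    2 * loss s.+1 * q ^ s.+1 * b0 * n.
Proof.
move=> q0 b00 m0 uE linE regE led.
pose C l := residue m q s.+1 (fun=> b0) E l S; rewrite -/(C m).
have le l : m * #|induced E (C l)| <=
    loss s.+1 * q ^ s.+1 * (m * (#|C l :\: C l.+1| * b0) + n * b0).
  have leC : forall u, degree (induced E (C l)) u <= b0 * q ^ s.+1.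
    move=> u; apply: leq_trans led; rewrite -(regE u); apply: degree_subset.
    by apply/subsetP => e; rewrite inE => /andP[].
  have uC : uniform_hypergraph s.+2 (induced E (C l)) by apply: induced_uniform.
  have linC : linear_edges (induced E (C l)) by apply: induced_linear.
  have := card_le_excl m (b := fun=> b0) S uC linC leC.
  by rewrite excl_residue // !sum_nat_const card_ord.
have sumC l : \sum_(k < l) #|C k :\: C k.+1| + #|C l| = n.
  elim: l => [|l IH]; first by rewrite big_ord0 /C /= cardsT card_ord.
  rewrite -[RHS]IH big_ord_recr /= -addnA; congr (_ + _).
  by rewrite -(cardsID (C l.+1) (C l)) addnC (setIidPr (residue_mono _ _ _ _ _ _ (leqnSn l))).
have [l leln] : exists l : 'I_m, m * #|C l :\: C l.+1| <= n.
  apply/existsP; apply: contraT => /existsPn gt.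
  have : \sum_(l < m) n.+1 <= \sum_(l < m) m * #|C l :\: C l.+1|.
    by apply: leq_sum => l _; rewrite ltnNge gt.
  rewrite sum_nat_const card_ord -big_distrr leq_mul2l eqn0Ngt m0.
  by rewrite leqNgt ltnS -[X in _ <= X](sumC m) leq_addr.
have mono : #|induced E (C m)| <= #|induced E (C l)|.
  apply/subset_leq_card/subsetP => e; rewrite !inE => /andP[->] /= /subset_trans; apply.
  exact/residue_mono/ltnW.
apply: leq_trans (_ : m * #|induced E (C l)| <= _); first by rewrite leq_mul2l mono orbT.
apply: leq_trans (le l) _.
apply: leq_trans (_ : loss s.+1 * q ^ s.+1 * (n * b0 + n * b0) <= _).
  by rewrite leq_mul2l leq_add2r mulnA leq_mul2r leln !orbT.
by rewrite leq_eqVlt; apply/orP; left; apply/eqP; ring.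
Qed.

(** * The two container systems *)

(** All that the colouring argument uses. The fingerprint of [I] is [I :&: sel I] and its container
    the complement of [excl I]. Fingerprints have measure at most [K / q], excluded sets at least
    [num / den], and prefixes of length at least [w0] are treated online. *)
Record container_system (n : nat) (E : {set {set 'I_n}}) (b : 'I_n -> nat)
    (w0 q K num den : nat) (sel excl : {set 'I_n} -> {set 'I_n}) : Prop := {
  fingerprint_sound : forall I, independent E I -> I :&: excl I \subset sel I;
  fingerprint_excl : forall I, excl (I :&: sel I) = excl I;
  fingerprint_small : forall I,
    q * \sum_(v in I :&: sel I) b v <= K * \sum_v b v;
  excl_online : forall (w : nat) (S S' : {set 'I_n}), w0 <= w <= n ->
    (forall v : 'I_n, v < w -> (v \in S) = (v \in S')) ->
    forall v : 'I_n, v < w -> (v \in excl S) = (v \in excl S');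
  excl_large : forall I, num * \sum_v b v <= den * \sum_(v in excl I) b v }.

(** [b] is the degree in units of [Q], rounded up. With [r = s.+2], the excluded proportion
    [num / den] is [m / ((m + 1) r^(r-1)) - 1/m], which tends to [r^-(r-1)] as [m] grows. *)
Lemma min_degree_containers (n m q s w0 : nat) (E : {set {set 'I_n}})
    (Q := q ^ s.+1) (b := fun u => degree E u %/ Q + 1) :
  0 < q -> uniform_hypergraph s.+2 E -> linear_edges E ->
  (forall u, m * Q <= degree E u) ->
  container_system E b w0 q (s.+1 * m) (m * m - m.+1 * s.+2 ^ s.+1)
    (m.+1 * s.+2 ^ s.+1 * m) (sel m q b s.+1 E) (excl m q b s.+1 E).
Proof.
move=> q0 uE linE mindeg; have b0 u : 0 < b u by rewrite /b addn1.
have Q0 : 0 < Q by rewrite expn_gt0 q0.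
split=> [I indI|I|I|w S S' _ SS' v ltvw|I].
- exact: excl_independent.
- by have [] := @sel_sandwich n m q b s.+1 E I (I :&: sel m q b s.+1 E I)
    (subxx _) (subsetIl _ _).
- exact: sel_weight.
- apply: (@excl_agree _ _ _ _ _ _ _ _ _ v) => // j ltjv.
  exact/SS'/(ltn_trans ltjv).
set B := \sum_v _; set M := \sum_(v in _) _.
have le u : degree E u <= b u * Q.
  by rewrite /b mulnDl mul1n {1}(divn_eq (degree E u) Q) leq_add2l ltnW ?ltn_mod.
have leE : m * #|E| <= s.+2 ^ s * Q * (m * M + B).
  apply: leq_trans (card_le_excl m I uE linE le) _.
  by rewrite !leq_mul2r loss_le !orbT.
(* The minimum degree pays for the rounding: [m * (degree E u + Q)] is at most
   [m.+1 * degree E u]. *)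
have leB : m * B * Q <= m.+1 * s.+2 * #|E|.
  rewrite -mulnA [B * Q]big_distrl big_distrr -mulnA -(sum_degree uE) big_distrr /=.
  apply: leq_sum => u _; rewrite mulSn addnC /b mulnDl mul1n mulnDr.
  by rewrite leq_add // leq_mul2l leq_trunc_div orbT.
rewrite mulnBl leq_subLR -(leq_pmul2r Q0).
apply: leq_trans (_ : m * (m.+1 * s.+2 * #|E|) <= _).
  by rewrite -2!mulnA leq_mul2l mulnA leB orbT.
apply: leq_trans (_ : m.+1 * s.+2 * (s.+2 ^ s * Q * (m * M + B)) <= _).
  by rewrite mulnCA leq_mul2l leE orbT.
by rewrite leq_eqVlt expnS; apply/orP; left; apply/eqP; ring.
Qed.

(** Few edges lie inside the residue, and each removed vertex destroys at most [d] of the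
    [d * n / r] edges, so nearly [n / r] vertices are removed. Survival of an edge into the next
    round depends on all its vertices, so onlineness is claimed only for the full prefix
    [w0 = n]. *)
Lemma regular_containers (n m q s d : nat) (E : {set {set 'I_n}})
    (Q := q ^ s.+1) (b0 := d %/ Q + 1) :
  0 < q -> 0 < m -> uniform_hypergraph s.+2 E -> linear_edges E ->
  (forall u, degree E u = d) -> Q <= d ->
  container_system E (fun=> b0) n q (m * (s.+1 * m)) (m - 4 * s.+2 ^ s.+1)
    (s.+2 * m) (round_sel m q s.+1 (fun=> b0) E m)
    (fun S => ~: residue m q s.+1 (fun=> b0) E m S).
Proof.
move=> q0 m0 uE linE regE leQd; have b00 : 0 < b0 by rewrite /b0 addn1.
have Q0 : 0 < Q by rewrite expn_gt0 q0.
split=> [I indI|I|I|w S S' lew SS' v ltvw|I].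
- by rewrite -setDE; apply: round_excl.
- by rewrite (round_sandwich (subxx _) (subsetIl _ _)).
- exact: round_weight.
- have -> // : S = S'; apply/setP => u; apply: SS'.
  by case/andP: lew => /(leq_trans (ltn_ord u)).
rewrite !sum_nat_const card_ord !mulnA leq_mul2r; apply/orP; right.
have led : d <= b0 * Q.
  by rewrite /b0 mulnDl mul1n {1}(divn_eq d Q) leq_add2l ltnW ?ltn_mod.
have leb : b0 * Q <= 2 * d.
  by rewrite /b0 mulnDl mul1n mul2n -addnn leq_add ?leq_trunc_div.
have := card_residue I q0 b00 m0 uE linE regE led.
set C := residue _ _ _ _ _ _ _ => leC.
have sumE : d * n = s.+2 * #|E|.
  by rewrite -(sum_degree uE) (eq_bigr (fun=> d)) ?sum_nat_const ?card_ord 1?mulnC.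
have leE : #|E| <= #|~: C| * d + #|induced E C|.
  apply: leq_trans (_ : #|[set e in E | ~~ (e \subset C)]| + #|induced E C| <= _).
    apply: leq_trans (leq_card_setU _ _); apply/subset_leq_card/subsetP => e eE.
    by rewrite !inE eE; case: (e \subset C).
  rewrite leq_add2r -sum_nat_const.
  apply: leq_trans (_ : \sum_(u in ~: C) degree E u <= _).
    apply: card_meeting; first by apply/subsetP => e; rewrite inE => /andP[].
    move=> e; rewrite inE => /andP[_ /subsetPn[u ue uC]]; exists u => //.
    by rewrite inE.
  by apply: leq_sum => u _; rewrite regE.
have d0 : 0 < d by apply: leq_trans leQd.
rewrite mulnBl leq_subLR -(leq_pmul2r d0).
have le1 : m * (s.+2 * #|E|) <= m * (s.+2 * (#|~: C| * d + #|induced E C|)).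
  by rewrite !leq_mul2l leE !orbT.
have le2 : s.+2 * (m * #|induced E C|) <= s.+2 * (2 * s.+2 ^ s * (2 * d) * n).
  rewrite leq_mul2l; apply/orP; right; apply: leq_trans leC _.
  rewrite -/Q leq_mul2r -mulnA [Q * b0]mulnC leq_mul ?orbT //.
  by rewrite leq_mul2l loss_le.
have -> : m * n * d = m * (s.+2 * #|E|) by rewrite -sumE; ring.
apply: leq_trans le1 _.
have -> : m * (s.+2 * (#|~: C| * d + #|induced E C|)) =
   s.+2 * m * #|~: C| * d + s.+2 * (m * #|induced E C|) by ring.
rewrite mulnDl addnC leq_add2r; apply: leq_trans le2 _.
by rewrite leq_eqVlt expnS; apply/orP; left; apply/eqP; ring.
Qed.

(** * Passing to subhypergraphs with ordered vertices *)

Definition pullback (T U : finType) (f : U -> T) (E : {set {set T}}) :=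
  [set e : {set U} | f @: e \in E].

Section Pullback.
Variables (T U : finType) (f : U -> T) (E : {set {set T}}).
Hypothesis f_inj : injective f.

Lemma pullback_uniform r : uniform_hypergraph r E ->
  uniform_hypergraph r (pullback f E).
Proof. by move=> uE e; rewrite inE => /uE; rewrite card_imset. Qed.

Lemma pullback_linear : linear_edges E -> linear_edges (pullback f E).
Proof.
move=> linE e e' x y; rewrite !inE => eE e'E xy xe ye xe' ye'.
apply: (imset_inj f_inj); apply: (linE _ _ (f x) (f y)) => //.
- by rewrite (inj_eq f_inj).
all: exact: imset_f.
Qed.

Lemma pullback_degree x :
  degree (pullback f E) x = degree (induced E (f @: U)) (f x).
Proof.
rewrite /degree -[LHS](card_imset _ (imset_inj f_inj)).
apply: eq_card => e.
apply/imsetP/idP => [[e']|].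
  rewrite !inE => /andP[e'E xe'] ->; rewrite e'E imset_f // andbT.
  by apply/subsetP => y /imsetP[z _ ->]; apply: imset_f.
rewrite !inE => /andP[/andP[eE sub] fxe].
have ee : e = f @: (f @^-1: e).
  apply/setP => y; apply/idP/imsetP => [ye|[z + ->]]; last by rewrite inE.
  by have /imsetP[z _ yz] := subsetP sub y ye; exists z; rewrite // inE -yz.
by exists (f @^-1: e); rewrite // !inE -ee eE fxe.
Qed.

End Pullback.

Lemma choosable_pullback (T U : finType) (f : U -> T) (E : {set {set T}}) k :
  injective f -> 0 < #|U| -> choosable E k -> choosable (pullback f E) k.
Proof.
move=> f_inj /card_gt0P[u0 _] chE C L cardL.
pose L' v := L (odflt u0 [pick u | f u == v]).
have [c [cL nmono]] := chE C L' (fun v => cardL _).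
have L'f u : L' (f u) = L u.
  rewrite /L'; case: pickP => [u' /eqP/f_inj -> //|/(_ u)].
  by rewrite eqxx.
exists (c \o f); split=> [u|e]; first by rewrite -L'f; apply: cL.
rewrite inE => /nmono nm mono; apply: nm => x y /imsetP[u ue ->] /imsetP[v ve ->].
exact: mono.
Qed.

Lemma sorted_enumeration (T : finType) (W : {set T}) (g : T -> nat) :
  exists f : 'I_#|W| -> T, [/\ injective f, f @: 'I_#|W| = W &
    forall i j : 'I_#|W|, i <= j -> g (f j) <= g (f i)].
Proof.
pose s := sort (fun x y => g y <= g x) (enum W).
have sz : size s = #|W| by rewrite size_sort cardE.
have us : uniq s by rewrite sort_uniq enum_uniq.
have ss : sorted (fun x y => g y <= g x) s.
  by apply: sort_sorted => x y; apply: leq_total.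
(* [nth] requires a default vertex, so the empty set is treated apart. *)
case: (set_0Vmem W) => [W0|[x0 x0W]].
  rewrite W0 cards0; exists (fun i : 'I_0 => let: Ordinal _ lt := i in
    False_rect _ (notF lt)).
  split; [by case| |by case].
  by apply/setP => x; rewrite inE; apply/negP => /imsetP[[]].
exists (fun i => nth x0 s i); split.
- move=> i j /eqP; rewrite nth_uniq ?sz // => /eqP; exact: val_inj.
- apply/setP => x; have -> : (x \in W) = (x \in s) by rewrite mem_sort mem_enum.
  apply/imsetP/idP => [[i _ ->]|xs]; first by rewrite mem_nth ?sz.
  have lt : index x s < #|W| by rewrite -sz index_mem.
  by exists (Ordinal lt); rewrite //= nth_index.
move=> i j; rewrite leq_eqVlt => /orP[/eqP/val_inj -> //|ltij].
have tr : transitive (fun x y => g y <= g x) by move=> y x z le1 le2; apply: leq_trans le2 le1.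
by apply: (sorted_ltn_nth tr x0 ss); rewrite // inE sz.
Qed.

(* A minimal set of vertices whose density is at least that of [E]: deleting a
   vertex of degree at most [#|E| / #|T|] would preserve the density. *)
Lemma min_degree_subgraph (T : finType) (E : {set {set T}}) :
  (forall e, e \in E -> 1 < #|e|) -> 0 < #|E| ->
  exists2 W : {set T}, 0 < #|W| &
    forall v, v \in W -> #|E| < #|T| * degree (induced E W) v.
Proof.
move=> cE E0; pose dense (W : {set T}) := (0 < #|W|) && (#|E| * #|W| <= #|T| * #|induced E W|).
have T0 : 0 < #|T|.
  case/card_gt0P: E0 => e /cE /ltnW/card_gt0P[x _]; exact/card_gt0P/(ex_intro _ x).
have denseT : dense [set: T].
  rewrite /dense cardsT T0 mulnC leq_mul2l; apply/orP; right.
  by apply/subset_leq_card/subsetP => e eE; rewrite inE eE subsetT.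
have [W /andP[W0 leW] Wmin] := arg_minnP (fun W : {set T} => #|W|) denseT.
exists W => // v vW.
have cW : #|W| = #|W :\ v|.+1 by rewrite (cardsD1 v) vW.
have ind : #|induced E W| <= #|induced E (W :\ v)| + degree (induced E W) v.
  rewrite addnC; apply: leq_trans (leq_card_setU _ _).
  apply/subset_leq_card/subsetP => e; rewrite !inE => /andP[eE eW].
  by rewrite eE eW subsetD1 eW /=; case: (v \in e).
have : ~~ dense (W :\ v) by apply/negP => /Wmin; rewrite cW ltnn.
rewrite negb_and -leqNgt leqn0 -ltnNge => /orP[|lt]; last first.
  have := leq_mul (leqnn #|T|) ind; rewrite mulnDr; move: leW; rewrite cW mulnS.
  by move: lt; lia.
rewrite cards_eq0 => /eqP Wv; rewrite cW Wv cards0 muln1 in leW.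
suff ind0 : induced E W = set0 by rewrite ind0 cards0 muln0 leqNgt E0 in leW.
apply/setP => e; rewrite !inE; apply/negP => /andP[/cE lt1 /subset_leq_card].
by rewrite cW Wv cards0 leqNgt lt1.
Qed.

(** By linearity the edges through [v] are otherwise disjoint, so choosing another vertex in each is
    injective. *)
Lemma degree_le (T : finType) (E : {set {set T}}) v :
  (forall e, e \in E -> 1 < #|e|) -> linear_edges E -> degree E v <= #|T|.
Proof.
move=> cE linE.
pose star := [set e in E | v \in e].
have other e : e \in star -> exists2 u, u \in e & u != v.
  rewrite inE => /andP[/cE + ve]; rewrite (cardsD1 v) ve => /card_gt0P[u].
  by rewrite !inE => /andP[]; exists u.
pose g (e : {set T}) := odflt v [pick u in e | u != v].
have gP e : e \in star -> g e \in e /\ g e != v.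
  move=> /other[u ue uv]; rewrite /g; case: pickP => [x /andP[]|/(_ u)] //.
  by rewrite ue uv.
rewrite -[degree E v]/#|star| -(card_in_imset (f := g)) ?max_card // => e e' es e's gg.
have [[ge gv] [ge' _]] := (gP e es, gP e' e's).
move: es e's; rewrite !inE => /andP[eE ve] /andP[e'E ve'].
by apply: (linE _ _ (g e) v) => //; rewrite gg.
Qed.

(** * Random lists *)

From mathcomp Require Import finmap reals sequences exp.

Import Order.TTheory GRing.Theory Num.Theory.

Lemma ffact_le_exp t k : t ^_ k <= t ^ k.
Proof.
elim: k t => // k IH [|t]; rewrite ?ffact0n // ffactSS expnS leq_mul //.
apply: leq_trans (IH t) _; case: k {IH} => // k; by rewrite leq_exp2r.
Qed.

Lemma exp_le_ffact z k : (z - k) ^ k <= z ^_ k.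
Proof.
elim: k z => // k IH [|z]; first by rewrite sub0n exp0n.
by rewrite ffactSS subSS expnS leq_mul // ltnW // ltnS leq_subr.
Qed.

(** A random [k]-subset of [t] colours lies inside a given set of [z] colours with probability at
    least [((z - k) / t) ^ k]. *)
Lemma bin_ratio (t z k : nat) : 'C(t, k) * (z - k) ^ k <= 'C(z, k) * t ^ k.
Proof.
rewrite -(leq_pmul2r (fact_gt0 k)) mulnAC bin_ffact [leqRHS]mulnAC bin_ffact.
by rewrite mulnC leq_mul ?ffact_le_exp ?exp_le_ffact.
Qed.

Local Open Scope ring_scope.

Lemma sum_expr_card (R : realDomainType) (T : finType) (U : {set T}) (x : R) :
  0 <= x -> \sum_(A : {set T} | A \subset U) x ^+ #|A| <= (1 + x) ^+ #|U|.
Proof.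
move=> x0.
have -> : (1 + x) ^+ #|U| = \prod_i ((if i \in U then x else 0) + 1).
  rewrite -prodr_const big_mkcond; apply: eq_bigr => i _.
  by case: ifP; rewrite ?add0r // addrC.
rewrite bigA_distr big_mkcond; apply: ler_sum => A _.
have ge0 : 0 <= \prod_i (if i \in A then (if i \in U then x else 0) else 1).
  by apply: prodr_ge0 => i _; case: ifP => // _; case: ifP.
case: ifP => // sAU; rewrite -prodr_const big_mkcond; apply: ler_prod => i _.
case: ifP => iA; last by rewrite ler01 lexx.
by rewrite (subsetP sAU _ iA) x0 lexx.
Qed.

Lemma sum_geometric_tail (R : realDomainType) (x : R) (a n : nat) : 0 <= x ->
  (1 - x) * (\sum_(w < n.+1 | (a <= w)%N) x ^+ w) <= x ^+ a.
Proof.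
move=> x0; have [lt|le] := ltnP n a.
  rewrite big_pred0 ?mulr0 ?exprn_ge0 // => w.
  by apply/negbTE; rewrite -ltnNge (leq_trans (ltn_ord w)).
suff -> : (1 - x) * (\sum_(w < n.+1 | (a <= w)%N) x ^+ w) = x ^+ a - x ^+ n.+1.
  by rewrite gerBl exprn_ge0.
elim: n le => [|n IH]; first rewrite leqn0 => /eqP ->.
  by rewrite big_ord_recr big_ord0 /= add0r mulr1 expr0 expr1.
rewrite leq_eqVlt big_mkcond big_ord_recr -big_mkcond /= => /orP[/eqP ->|].
  rewrite leqnn big_pred0 ?add0r ?mulrBl ?mul1r -?exprS // => w.
  by apply/negbTE; rewrite -ltnNge ltn_ord.
rewrite ltnS => le; rewrite leqW // mulrDr IH // mulrBl mul1r -exprS; ring.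
Qed.

(** A union bound by counting: at most a fraction [(1 - rho) ^+ #|X phi|] of all assignments avoids
    the bad lists of [phi] throughout [X phi]. *)
Lemma random_assignment (R : realFieldType) (V L Conf : finType)
    (lists : {set L}) (P : pred Conf) (X : Conf -> {set V})
    (bad : Conf -> V -> {set L}) (rho : R) :
  (0 < #|lists|)%N -> rho <= 1 ->
  (forall phi v, P phi -> v \in X phi ->
    rho * #|lists|%:R <= #|bad phi v :&: lists|%:R) ->
  \sum_(phi | P phi) (1 - rho) ^+ #|X phi| < 1 ->
  exists2 f : V -> L, (forall v, f v \in lists) &
    forall phi, P phi -> exists2 v, v \in X phi & f v \in bad phi v.
Proof.
move=> lists0 rho1 badP lt1.
pose F phi v := if v \in X phi then lists :\: bad phi v else lists.
pose fam phi := [set f : {ffun V -> L} | f \in family (F phi)].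
case: (boolP [exists f : {ffun V -> L}, [forall v, f v \in lists] &&
    [forall (phi | P phi), exists v in X phi, f v \in bad phi v]]).
  case/existsP=> f /andP[/forallP fl /forall_inP fb]; exists f => // phi Pphi.
  exact/exists_inP/fb.
move/existsPn => nof; exfalso.
have cover : [set f : {ffun V -> L} | f \in ffun_on (mem lists)] \subset
    \bigcup_(phi | P phi) fam phi.
  apply/subsetP => f; rewrite inE => /ffun_onP fl.
  have := nof f; rewrite negb_and => /orP[/forallPn[v]|]; first by rewrite fl.
  case/forall_inPn=> phi Pphi /exists_inPn avoid.
  apply/bigcupP; exists phi => //; rewrite inE; apply/familyP => v; rewrite /F.
  by case: ifP => vX; rewrite ?inE fl // avoid.
have leF phi : P phi -> #|fam phi|%:R <=
    (1 - rho) ^+ #|X phi| * #|lists|%:R ^+ #|V| :> R.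
  move=> Pphi; rewrite cardsE card_family foldrE big_map big_enum natr_prod /=.
  have -> : (1 - rho) ^+ #|X phi| * #|lists|%:R ^+ #|V| =
      \prod_v ((if v \in X phi then 1 - rho else 1) * #|lists|%:R) :> R.
    by rewrite big_split /= -big_mkcond !prodr_const; congr (_ * _ ^+ _).
  rewrite [leLHS](eq_bigl xpredT) //; apply: ler_prod => v _.
  rewrite ler0n /F; case: ifP => vX /=; last by rewrite mul1r lexx.
  have := badP phi v Pphi vX; have := cardsID (bad phi v) lists.
  by rewrite setIC => /(congr1 (fun c => c%:R : R)); rewrite natrD; lra.
have := subset_leq_card cover.
rewrite cardsE card_ffun_on => leN.
have : #|lists|%:R ^+ #|V| <= \sum_(phi | P phi) #|fam phi|%:R :> R.
  rewrite -natrX -natr_sum ler_nat; apply: leq_trans leN _.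
  elim/big_rec2: _ => [|phi c A _ le]; first by rewrite cards0.
  exact: leq_trans (leq_card_setU _ _) (leq_add (leqnn _) le).
have N0 : 0 < #|lists|%:R ^+ #|V| :> R by rewrite exprn_gt0 // ltr0n.
move=> /le_trans/(_ (ler_sum _ leF)); rewrite -mulr_suml leNgt => /negP; apply.
by rewrite gtr_pMl.
Qed.

(* [S j] is the fingerprint of the class of colour [j], and the complement of
   [excl (S j)] its container: a vertex with a missing colour cannot be in the
   class of that colour. *)
Definition missing (n t : nat) (excl : {set 'I_n} -> {set 'I_n})
    (S : 'I_t -> {set 'I_n}) (v : 'I_n) : {set 'I_t} :=
  [set j | (v \in excl (S j)) && (v \notin S j)].

Definition initial (n w : nat) : {set 'I_n} := [set v : 'I_n | (v < w)%N].
Arguments initial {n} w.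

(** * The union bound over fingerprints *)

Section Colouring.
Variables (R : realType) (n t k z w0 q K num den : nat).
Variables (E : {set {set 'I_n}}) (b : 'I_n -> nat).
Variables (sel excl : {set 'I_n} -> {set 'I_n}).
Hypothesis sys : container_system E b w0 q K num den sel excl.
(** In a prefix, [kappa] is the density of vertices with at least [z] missing colours and [tau] that
    of fingerprint entries; [rho] is the chance that a list consists of missing colours. [lambda]
    penalises large fingerprints in the union bound, and [beta] is the resulting decay rate per
    vertex. *)
Variables (kappa rho tau lambda beta : R).
Hypothesis bin_rho : rho * 'C(t, k)%:R <= 'C(z, k)%:R.
Hypotheses (rho_ge0 : 0 <= rho) (rho_le1 : rho <= 1).
Hypothesis (k_le_t : (k <= t)%N).
Hypothesis beta_le : beta <= rho * kappa - lambda * tau - t%:R * expR (- lambda).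
Hypothesis beta_gt0 : 0 < beta.
Hypothesis lambda_ge0 : 0 <= lambda.
Hypothesis tail : expR (- beta) ^+ w0 < 1 - expR (- beta).
Hypothesis prefix_exists : forall I : 'I_t -> {set 'I_n},
  exists w : nat, [/\ (w0 <= w <= n)%N,
    kappa * w%:R <= #|[set v in initial w |
      (z <= #|missing excl (fun j => I j :&: sel (I j)) v|)%N]|%:R &
    (\sum_j #|I j :&: sel (I j) :&: initial w|)%:R <= tau * w%:R].

(** A configuration is a prefix length together with the traces of all [t] fingerprints on that
    prefix, coded as one set of vertex-colour pairs. *)
Let conf := ('I_n.+1 * {set 'I_n * 'I_t})%type.
Let box (w : nat) : {set 'I_n * 'I_t} := [set p : 'I_n * 'I_t | (p.1 < w)%N].
Let traces (phi : conf) (j : 'I_t) : {set 'I_n} := [set v | (v, j) \in phi.2].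
Let X (phi : conf) : {set 'I_n} :=
  [set v in initial phi.1 | (z <= #|missing excl (traces phi) v|)%N].
Let relevant (phi : conf) : bool :=
  [&& (w0 <= phi.1)%N, phi.2 \subset box phi.1,
      #|phi.2|%:R <= tau * phi.1%:R & kappa * phi.1%:R <= #|X phi|%:R].

(** The factor [expR (lambda * (tau * w - #|S|))] is at least 1 on relevant configurations. With it
    inserted, the sum may run over all subsets of the box, giving at most
    [expR (t * w * expR (- lambda))]; a geometric series over [w] remains. *)
Lemma sum_relevant : \sum_(phi | relevant phi) (1 - rho) ^+ #|X phi| < 1.
Proof.
have one_sub : 1 - rho <= expR (- rho) by have := expR_ge1Dx (- rho); lra.
have le1 phi : relevant phi -> (1 - rho) ^+ #|X phi| <=
    expR (- (rho * kappa - lambda * tau) * phi.1%:R) * expR (- lambda) ^+ #|phi.2|.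
  case/and4P => _ _ sizeS sizeX.
  apply: (@le_trans _ _ (expR (- rho) ^+ #|X phi|)).
    by apply: lerXn2r => //; rewrite ?nnegrE ?subr_ge0 ?expR_ge0.
  rewrite -!expRM_natr -expRD ler_expR.
  by have := ler_wpM2l rho_ge0 sizeX; have := ler_wpM2l lambda_ge0 sizeS; lra.
apply: le_lt_trans (ler_sum _ le1) _.
pose f (w : 'I_n.+1) := expR (- (rho * kappa - lambda * tau) * w%:R).
apply: (@le_lt_trans _ _ (\sum_(w < n.+1 | (w0 <= w)%N)
    \sum_(S : {set 'I_n * 'I_t} | S \subset box w)
    f w * expR (- lambda) ^+ #|S|)).
  rewrite pair_big_dep big_mkcond [leRHS]big_mkcond; apply: ler_sum => phi _ /=.
  rewrite /relevant; case: (w0 <= _)%N => //=; case: (_ \subset _) => //=.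
  by case: ifP => // _; rewrite mulr_ge0 ?exprn_ge0 ?expR_ge0.
apply: (@le_lt_trans _ _ (\sum_(w < n.+1 | (w0 <= w)%N) expR (- beta) ^+ w)).
  apply: ler_sum => w _; rewrite -mulr_sumr.
  apply: le_trans (ler_wpM2l (expR_ge0 _) (sum_expr_card _ (expR_ge0 _))) _.
  have cardU : #|box w| = (w * t)%N.
    have -> : #|box w| = #|[predX @initial n w & 'I_t]|.
      by apply: eq_card => p; rewrite !inE andbT.
    rewrite cardX card_ord; congr (_ * _)%N.
    have -> : initial w = [set widen_ord (ltnSE (ltn_ord w)) i | i in [set: 'I_w]].
      apply/setP => v; rewrite inE; apply/idP/imsetP => [lt|[i _ ->]] //=.
      by exists (Ordinal lt); rewrite ?inE //; apply: val_inj.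
    rewrite card_imset ?cardsT ?card_ord // => i j /(congr1 val) /= ij.
    exact: val_inj.
  rewrite cardU.
  apply: (@le_trans _ _ (f w * expR (expR (- lambda)) ^+ (w * t))).
    apply: ler_wpM2l; first exact: expR_ge0.
    apply: lerXn2r; rewrite ?nnegrE ?addr_ge0 ?expR_ge0 // expR_ge1Dx //.
  rewrite /f -!expRM_natr -expRD ler_expR natrM.
  have := ler_wpM2r (ler0n R w) beta_le; lra.
have lt1 : 0 < 1 - expR (- beta) by rewrite subr_gt0 expR_lt1 oppr_lt0.
rewrite -(ltr_pM2l lt1) mulr1; apply: le_lt_trans tail.
exact/sum_geometric_tail/expR_ge0.
Qed.

Lemma not_choosable_of_containers : ~ choosable E k.
Proof.
pose lists : {set {set 'I_t}} := [set A : {set 'I_t} | #|A| == k].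
have cardlists : #|lists| = 'C(t, k).
  by rewrite /lists card_draws card_ord.
pose bad (phi : conf) (v : 'I_n) : {set {set 'I_t}} :=
  [set A : {set 'I_t} | A \subset missing excl (traces phi) v].
have lists0 : (0 < #|lists|)%N by rewrite cardlists bin_gt0.
have badP phi v : relevant phi -> v \in X phi ->
    rho * #|lists|%:R <= #|bad phi v :&: lists|%:R.
  move=> _ vX; rewrite cardlists; apply: le_trans bin_rho _; rewrite ler_nat.
  move: vX; rewrite inE => /andP[_ lez].
  have -> : bad phi v :&: lists = [set A : {set 'I_t} |
      A \subset missing excl (traces phi) v & #|A| == k].
    by apply/setP => A; rewrite !inE.
  by rewrite cards_draws leq_bin2l.
have [f fl fb] := random_assignment lists0 rho_le1 badP sum_relevant.
move=> chE.
pose L v : {fset 'I_t} := [fset j in f v]%fset.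
have cardL v : #|` L v| = k.
  by have := fl v; rewrite inE card_finset => /eqP.
have [c [cL nmono]] : exists c : 'I_n -> 'I_t, (forall v, c v \in L v) /\
    (forall e, e \in E -> ~ monochromatic c e) by exact: chE cardL.
have cf v : c v \in f v by have := cL v; rewrite inE.
pose I (j : 'I_t) : {set 'I_n} := [set v | c v == j].
have indI j : independent E (I j).
  move=> e eE; apply/negP => /subsetP sub; apply: (nmono e eE) => x y xe ye.
  by have := sub x xe; have := sub y ye; rewrite !inE => /eqP -> /eqP.
pose T j := I j :&: sel (I j).
have [w [w_range leX leT]] := prefix_exists I.
have ltw : (w < n.+1)%N by case/andP: w_range.
(* The configuration read off the colour classes of the assumed proper colouring. *)
pose phi : conf := (Ordinal ltw, [set p | (p.1 \in T p.2) && (p.1 < w)%N]).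
have tracesE j : traces phi j = T j :&: initial w.
  by apply/setP => v; rewrite !inE.
(* Onlineness: on the prefix, truncated fingerprints give the same missing colours as full ones. *)
have missingE (v : 'I_n) : (v < w)%N -> missing excl (traces phi) v = missing excl T v.
  move=> ltv; apply/setP => j; rewrite !in_set.
  have -> : (v \in excl (traces phi j)) = (v \in excl (T j)).
    by apply: (excl_online sys w_range) => // u ltu; rewrite tracesE !inE ltu andbT.
  by rewrite /= ltv !andbT.
have XE : X phi = [set v in initial w | (z <= #|missing excl T v|)%N].
  by apply/setP => v; rewrite !inE /=; case: ltnP => //= /missingE ->.
have rel : relevant phi.
  apply/and4P; split.
  - by case/andP: w_range.
  - by apply/subsetP => p; rewrite !inE => /andP[].
  - apply: le_trans leT; rewrite ler_nat -sum1_card.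
    rewrite (eq_bigl (fun p => predT p.2 && (p.1 \in traces phi p.2))); last first.
      by move=> p; rewrite !inE.
    rewrite (eq_bigr (fun p : 'I_n * 'I_t => 1%N)) //.
    rewrite -(pair_big_dep xpredT (fun i j => i \in traces phi j) (fun _ _ => 1%N)) /=.
    rewrite (exchange_big_dep xpredT) //=; apply: leq_sum => j _.
    by rewrite sum1_card -tracesE.
  - by rewrite XE.
(* All colours in the list of [v] are missing, including [c v], although [v] is in that colour
   class; soundness puts [v] in the fingerprint, a contradiction. *)
have [v] := fb phi rel; rewrite XE inE => /andP[]; rewrite inE => ltv _.
rewrite inE => /subsetP/(_ _ (cf v)); rewrite missingE // inE => /andP[].
rewrite (fingerprint_excl sys) => vex /negP; apply.
have vI : v \in I (c v) by rewrite inE.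
rewrite in_setI vI; apply: (subsetP (fingerprint_sound sys (indI (c v)))).
by rewrite in_setI vI.
Qed.

End Colouring.

(** * Prefixes of a decreasing weight *)

Lemma initialS n (i : 'I_n) : initial i.+1 = i |: initial i.
Proof.
by apply/setP => v; rewrite !inE ltnS leq_eqVlt -val_eqE.
Qed.

Lemma initial_full n : initial n = [set: 'I_n].
Proof. by apply/setP => v; rewrite !inE ltn_ord. Qed.

Lemma card_initial n w : (w <= n)%N -> #|@initial n w| = w.
Proof.
move: w; apply: scan_ind => [|i IH].
  by apply: eq_card0 => v; rewrite inE.
by rewrite initialS cardsU1 IH inE ltnn.
Qed.

(* Summation by parts: a sum weighted by a nonincreasing [b] is a nonnegative
   combination of the prefix sums. *)
Lemma exists_positive_prefix (R : realDomainType) n (b : 'I_n -> nat) (g : 'I_n -> R) :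
  (forall i j : 'I_n, (i <= j)%N -> (b j <= b i)%N) -> 0 < \sum_v (b v)%:R * g v ->
  exists2 w : nat, (w <= n)%N & 0 < \sum_(v in initial w) g v.
Proof.
move=> b_mono pos; pose G w := \sum_(v in @initial n w) g v.
have [/existsP[w posw]|/existsPn neg] := boolP [exists w : 'I_n.+1, 0 < G w].
  by exists w; rewrite -1?ltnS.
have G_le0 w : (w <= n)%N -> G w <= 0.
  by move=> lew; rewrite leNgt (neg (Ordinal (lew : (w < n.+1)%N))).
have key : forall w, (w <= n)%N -> forall c : nat,
    (forall v : 'I_n, (v < w)%N -> (c <= b v)%N) ->
    \sum_(v in initial w) (b v)%:R * g v <= c%:R * G w.
  apply: scan_ind => [c _|i IH c le_c].
    by rewrite /G !big_pred0 ?mulr0 // => v; rewrite inE.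
  have GS : G i.+1 = g i + G i by rewrite /G initialS big_setU1 // inE ltnn.
  have leb : c%:R <= (b i)%:R :> R by rewrite ler_nat le_c.
  have := IH (b i) (fun v lt => b_mono v i (ltnW lt)).
  have := ler_wnM2r (G_le0 i.+1 (ltn_ord i)) leb.
  by rewrite initialS big_setU1 ?inE ?ltnn //= GS; lra.
have := key n (leqnn n) 0%N (fun _ _ => leq0n _).
by rewrite mul0r initial_full (eq_bigl xpredT) ?leNgt ?pos // => v; rewrite inE.
Qed.

(** One function [g] encodes both requirements: its weighted sum is positive, so some prefix sum is
    positive. Removing [initial w0] from [X] makes shorter prefixes nonpositive, which forces
    [w0 <= w]. *)
Lemma exists_balanced_prefix (R : realFieldType) n (b : 'I_n -> nat) (w0 : nat)
    (X : {set 'I_n}) (a : 'I_n -> nat) (c tau : R) :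
  (forall i j : 'I_n, (i <= j)%N -> (b j <= b i)%N) ->
  (0 < \sum_v b v)%N -> 0 < c -> 0 < tau ->
  4 * (\sum_(v in initial w0) b v)%:R <= c * (\sum_v b v)%:R ->
  c * (\sum_v b v)%:R <= (\sum_(v in X) b v)%:R ->
  (\sum_v a v * b v)%:R <= tau * (\sum_v b v)%:R ->
  exists w : nat, [/\ (w0 <= w <= n)%N, c / 4 * w%:R <= #|X :&: initial w|%:R &
    (\sum_(v in initial w) a v)%:R <= 4 * tau / c * w%:R].
Proof.
move=> b_mono B0 c0 tau0; set B := (\sum_v b v)%:R => head heavy light.
pose X' := X :\: initial w0.
pose g v : R := (v \in X')%:R - c / 4 - c / (4 * tau) * (a v)%:R.
have B_gt0 : 0 < B by rewrite ltr0n.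
have [|w lewn] := exists_positive_prefix (b := b) (g := g) b_mono.
  have -> : \sum_v (b v)%:R * g v = (\sum_(v in X') b v)%:R - c / 4 * B -
      c / (4 * tau) * (\sum_v a v * b v)%:R.
    rewrite /B !natr_sum !mulr_sumr [X in X - _ - _]big_mkcond -!sumrB.
    apply: eq_bigr => v _; rewrite natrM /g; case: (v \in X'); rewrite ?mulr1n ?mulr0n; ring.
  have : c / (4 * tau) * (\sum_v a v * b v)%:R <= c / 4 * B.
    have -> : c / 4 * B = c / (4 * tau) * (tau * B).
      by field; rewrite gt_eqF.
    by rewrite ler_wpM2l // divr_ge0 ?mulr_ge0 // ltW.
  have : (\sum_(v in X) b v)%:R <= (\sum_(v in X') b v)%:R + (\sum_(v in initial w0) b v)%:R :> R.
    rewrite -natrD ler_nat; apply: leq_trans (leq_sum_setU _ _ _).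
    by apply: leq_sum_subset; apply/subsetP => v vX; rewrite !inE vX; case: ltnP.
  have := mulr_gt0 c0 B_gt0; lra.
have -> : \sum_(v in initial w) g v = #|X' :&: initial w|%:R - c / 4 * w%:R -
    c / (4 * tau) * (\sum_(v in initial w) a v)%:R.
  have cw : #|@initial n w| = w by exact: card_initial.
  rewrite -[in c / 4 * _]cw -!sum1_card !natr_sum !mulr_sumr.
  rewrite [X in X - _ - _](eq_bigl (fun v => (v \in initial w) && (v \in X'))); last first.
    by move=> v; rewrite in_setI andbC.
  rewrite [X in X - _ - _]big_mkcondr -!sumrB.
  by apply: eq_bigr => v _; rewrite /g; case: (v \in X'); rewrite ?mulr1n ?mulr0n; ring.
move=> pos.
have a0 : 0 <= c / (4 * tau) * (\sum_(v in initial w) a v)%:R.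
  by rewrite mulr_ge0 ?divr_ge0 ?mulr_ge0 // ltW.
have w0' : 0 <= c / 4 * w%:R by rewrite mulr_ge0 ?divr_ge0 // ltW.
have leX' : #|X' :&: initial w|%:R <= #|X :&: initial w|%:R :> R.
  by rewrite ler_nat subset_leq_card // setSI // subsetDl.
have leXw : #|X' :&: initial w|%:R <= w%:R :> R.
  rewrite ler_nat -[leqRHS](card_initial lewn).
  by rewrite subset_leq_card // subsetIr.
exists w; split.
- rewrite lewn andbT leqNgt; apply/negP => ltw.
  have : X' :&: initial w = set0.
    apply/setP => v; rewrite !inE; apply/negP => /andP[/andP[/negP nlt _] lt].
    exact/nlt/(ltn_trans lt).
  by move=> X'0; move: pos; rewrite X'0 cards0; lra.
- lra.
have -> : (\sum_(v in initial w) a v)%:R =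
    4 * tau / c * (c / (4 * tau) * (\sum_(v in initial w) a v)%:R) :> R.
  by field; rewrite !gt_eqF.
by rewrite ler_wpM2l ?divr_ge0 ?mulr_ge0 // ?ltW //; lra.
Qed.

(** * Heavy sets of missing colours and the choice of parameters *)

Lemma expr_dominates_square (R : realType) (theta C : R) : 1 < theta ->
  exists k0 : nat, forall k, (k0 <= k)%N -> C * k%:R ^+ 2 <= theta ^+ k.
Proof.
move=> theta1; have theta0 : 0 < theta by lra.
have l0 : 0 < ln theta by rewrite ln_gt0.
exists (Num.truncn (6 * `|C| / ln theta ^+ 3)).+1 => k lek.
have [k0|k0] := posnP k; first by rewrite k0 in lek.
have kC : 6 * `|C| / ln theta ^+ 3 <= k%:R.
  apply: (@le_trans _ _ (Num.truncn (6 * `|C| / ln theta ^+ 3)).+1%:R).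
    exact/ltW/truncnS_gt.
  by rewrite ler_nat.
have -> : theta ^+ k = expR (k%:R * ln theta) by rewrite mulrC expRM_natr lnK.
(* The cubic term of the exponential series beats [C * k ^ 2] once [k] is at least
   [6 * C / ln theta ^ 3]. *)
have := @expR_ge1Dxn R (k%:R * ln theta) 2 (mulr_ge0 (ler0n _ _) (ltW l0)).
rewrite ler_pdivrMr ?exprn_gt0 // in kC.
have := ler_wpM2r (exprn_ge0 2 (ler0n R k)) kC.
have := ler_wpM2r (exprn_ge0 2 (ler0n R k)) (ler_norm C).
rewrite exprMn (_ : 3`!%:R = 6 :> R) //.
have -> : k%:R ^+ 3 = k%:R * k%:R ^+ 2 :> R by rewrite exprS.
lra.
Qed.

(** Double counting of pairs of a vertex and a missing colour: a vertex with fewer than [z] missing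
    colours accounts for at most [z] of its [t] possible pairs. *)
Lemma heavy_missing (R : realFieldType) n t z w0 q K num den
    (E : {set {set 'I_n}}) (b : 'I_n -> nat) sel excl (I : 'I_t -> {set 'I_n})
    (T := fun j => I j :&: sel (I j)) :
  container_system E b w0 q K num den sel excl -> (0 < t)%N -> (0 < q)%N ->
  (0 < den)%N ->
  (num%:R / den%:R - K%:R / q%:R - z%:R / t%:R) * (\sum_v b v)%:R <=
    (\sum_(v | (z <= #|missing excl T v|)%N) b v)%:R :> R.
Proof.
move=> sys t0 q0 den0; set B := (\sum_v b v)%N.
have bound j : (num%:R / den%:R - K%:R / q%:R) * B%:R <=
    (\sum_(v in excl (T j) :\: T j) b v)%:R :> R.
  rewrite mulrBl [_ / den%:R * _]mulrAC [_ / q%:R * _]mulrAC lerBlDr.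
  apply: (@le_trans _ _ (\sum_(v in excl (I j)) b v)%:R).
    rewrite ler_pdivrMr ?ltr0n // -!natrM ler_nat [leqRHS]mulnC.
    exact: excl_large sys _.
  apply: (@le_trans _ _ ((\sum_(v in excl (T j) :\: T j) b v)%:R +
      (\sum_(v in T j) b v)%:R)).
    rewrite -natrD ler_nat; apply: leq_trans (leq_sum_setU _ _ _).
    rewrite (fingerprint_excl sys); apply: leq_sum_subset.
    by apply/subsetP => v vex; rewrite in_setU in_setD vex andbT orNb.
  rewrite lerD2l ler_pdivlMr ?ltr0n // -!natrM ler_nat mulnC.
  exact: fingerprint_small sys _.
have total : (\sum_j \sum_(v in excl (T j) :\: T j) b v <=
    t * \sum_(v | (z <= #|missing excl T v|)%N) b v + z * B)%N.
  have -> : (\sum_j \sum_(v in excl (T j) :\: T j) b v =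
      \sum_v #|missing excl T v| * b v)%N.
    rewrite (exchange_big_dep xpredT) //=; apply: eq_bigr => v _.
    rewrite -sum_nat_const; apply: eq_bigl => j.
    by rewrite !inE andbC.
  rewrite [X in (_ <= t * X + _)%N]big_mkcond /B !big_distrr -big_split /=.
  apply: leq_sum => v _.
  case: ifP => [_|/negbT]; last first.
    by rewrite -ltnNge muln0 add0n leq_mul2r => /ltnW ->; rewrite orbT.
  rewrite -mulnDl leq_mul2r; apply/orP; right; apply: leq_trans (leq_addr _ _).
  by rewrite -[leqRHS](card_ord t) max_card.
rewrite mulrBl lerBlDr -(ler_pM2l (_ : 0 < t%:R :> R)) ?ltr0n //.
apply: (@le_trans _ _ (\sum_j \sum_(v in excl (T j) :\: T j) b v)%:R).
  have -> (x : R) : t%:R * x = \sum_(j < t) x by rewrite sumr_const card_ord mulr_natl.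
  by rewrite natr_sum; apply: ler_sum => j _; apply: bound.
have -> : t%:R * ((\sum_(v | (z <= #|missing excl T v|)%N) b v)%:R + z%:R / t%:R * B%:R) =
    (t * \sum_(v | (z <= #|missing excl T v|)%N) b v + z * B)%:R :> R.
  by rewrite natrD !natrM; field; rewrite pnatr_eq0 -lt0n.
by rewrite ler_nat.
Qed.

(** With a palette of [O(k)] colours the gain [rho = alpha ^ k] exceeds [A ^ -k] exponentially,
    whereas fingerprints cost only a polynomial in [k] times [A ^ -k]. [c] is fixed before [Z], so
    that [Z] may depend on it. *)
Lemma asymptotic_not_choosable (R : realType) (num den : nat) (A : R) :
  (0 < den)%N -> (num <= den)%N -> 1 < A -> A^-1 < num%:R / den%:R ->
  exists2 c : R, 0 < c & forall (K : nat) (Z : R), 0 < Z -> exists k0 : nat,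
  forall k, (k0 <= k)%N -> forall n (E : {set {set 'I_n}}) b w0 q sel excl,
    container_system E b w0 q K num den sel excl -> (0 < \sum_v b v)%N ->
    A ^+ k <= q%:R -> A ^+ k <= Z * w0%:R ->
    (forall (X : {set 'I_n}) (a : 'I_n -> nat) (tau : R), 0 < tau ->
      c * (\sum_v b v)%:R <= (\sum_(v in X) b v)%:R ->
      (\sum_v a v * b v)%:R <= tau * (\sum_v b v)%:R ->
      exists w : nat, [/\ (w0 <= w <= n)%N, c / 4 * w%:R <= #|X :&: initial w|%:R &
        (\sum_(v in initial w) a v)%:R <= 4 * tau / c * w%:R]) ->
    ~ choosable E k.
Proof.
move=> den0 num_le A1 gap.
have A0 : 0 < A by lra.
have denR : 0 < den%:R :> R by rewrite ltr0n.
pose N := (Num.truncn (2 / (num%:R / den%:R - A^-1))).+1.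
have N_gap : 2 < (num%:R / den%:R - A^-1) * N%:R.
  rewrite mulrC -ltr_pdivrMr ?subr_gt0 //; exact: truncnS_gt.
have N0 : 0 < N%:R :> R by rewrite ltr0n.
have Ainv0 : 0 < A^-1 by rewrite invr_gt0.
(* The palette has [Zt * k] colours and [Yt * k] of them must be missing. [Yt / Zt] falls short of
   [num / den] by [1 / Zt], and half of this is [c]. *)
pose Zt := (den * N)%N; pose Yt := (num * N).-1.
have numN : 2 < num%:R * N%:R :> R.
  have : 2 < num%:R / den%:R * N%:R :> R by apply: lt_trans N_gap _; rewrite ltr_pM2r //; lra.
  rewrite mulrAC ltr_pdivlMr // => lt2; apply: le_lt_trans lt2.
  by rewrite ler_peMr // ler1n.
have YtE : Yt%:R = num%:R * N%:R - 1 :> R.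
  have : (0 < num * N)%N by rewrite -(ltr0n R) natrM; lra.
  by move=> /prednK; rewrite -/Yt => /(congr1 (fun i => i%:R : R)); rewrite natrM -natr1; lra.
have ZtE : Zt%:R = den%:R * N%:R :> R by rewrite natrM.
have Zt0 : 0 < Zt%:R :> R by rewrite ZtE mulr_gt0.
pose c : R := (2 * Zt%:R)^-1; have c0 : 0 < c by rewrite invr_gt0 mulr_gt0.
have cE : 2 * c = num%:R / den%:R - Yt%:R / Zt%:R.
  by rewrite /c YtE ZtE; field; rewrite !gt_eqF.
pose alpha : R := (Yt%:R - 1) / Zt%:R.
have alphaE : alpha = num%:R / den%:R - 2 / (den%:R * N%:R).
  by rewrite /alpha YtE ZtE; field; rewrite !gt_eqF.
have alphaA : A^-1 < alpha.
  rewrite alphaE ltrBrDr -ltrBrDl; apply: (@le_lt_trans _ _ (2 / N%:R)).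
    by rewrite ler_wpM2l // lef_pV2 ?posrE ?mulr_gt0 // ler_peMl ?ler1n // ltW.
  by rewrite ltr_pdivrMr.
have alpha0 : 0 < alpha by apply: lt_trans alphaA.
have num_le1 : num%:R / den%:R <= 1 :> R by rewrite ler_pdivrMr // mul1r ler_nat.
have alpha1 : alpha <= 1.
  have : 0 <= 2 / (den%:R * N%:R) :> R by rewrite divr_ge0 ?mulr_ge0 // ltW.
  by rewrite alphaE; lra.
have c1 : c <= 1 / 2.
  have : 0 <= Yt%:R / Zt%:R :> R by rewrite divr_ge0.
  by lra.
pose theta := alpha * A.
have theta1 : 1 < theta by rewrite -(mulVf (lt0r_neq0 A0)) ltr_pM2r.
have lnA0 : 0 < ln A by rewrite ln_gt0.
exists c => // K Z Z0.
(* The added 1 keeps [tau0] positive when [K] is 0. *)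
pose K' : R := K%:R + 1; have K'0 : 0 < K' by rewrite ltr_wpDl.
pose D : R := 4 * Zt%:R * K' / c.
have D0 : 0 < D by rewrite divr_gt0 ?mulr_gt0.
have ln16 : 0 < ln (16 / c).
  by rewrite ln_gt0 // ltr_pdivlMr // mul1r; lra.
(* For large [k], these bound the fingerprint cost by half the gain [rho * c / 4], make [beta * w0]
   exceed [lambda + ln (16 / c)], and give [K / q <= c]. *)
have [k1 dom1] := expr_dominates_square (8 / c * (ln A * D + Zt%:R)) theta1.
have [k2 dom2] := expr_dominates_square (8 * Z / c * (ln A + ln (16 / c) + 1)) theta1.
have [k3 dom3] := expr_dominates_square (K%:R / c) A1.
exists (maxn 1 (maxn k1 (maxn k2 k3))) => k lek n E b w0 q sel excl sys B0 leq_ lew find.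
move: lek; rewrite !geq_max => /and4P[k_gt0 lek1 lek2 lek3].
have kR : 1 <= k%:R :> R by rewrite ler1n.
have k2R : k%:R <= k%:R ^+ 2 :> R by rewrite expr2 ler_peMl.
have Ak0 : 0 < A ^+ k by rewrite exprn_gt0.
have q0 : 0 < q%:R :> R by apply: lt_le_trans leq_.
pose t := (Zt * k)%N; pose z := (Yt * k)%N; pose rho := alpha ^+ k.
have tR : t%:R = Zt%:R * k%:R :> R by rewrite natrM.
have t0 : 0 < t%:R :> R by rewrite tR mulr_gt0 // ltr0n.
have rho0 : 0 < rho by rewrite exprn_gt0.
have rho1 : rho <= 1 by rewrite exprn_ile1 // ltW.
have thetaE : theta ^+ k = rho * A ^+ k by rewrite exprMn.
pose lambda := k%:R * ln A.
have lambda0 : 0 <= lambda by rewrite mulr_ge0 // ltW.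
have expA : expR (- lambda) = (A ^+ k)^-1.
  by rewrite expRN /lambda mulrC expRM_natr lnK.
pose tau0 := t%:R * K' / q%:R.
have tau00 : 0 < tau0 by rewrite divr_gt0 ?mulr_gt0.
pose beta := rho * (c / 4) / 2.
have beta0 : 0 < beta by rewrite !(divr_gt0, mulr_gt0).
have domk1 : 8 / c * (ln A * D + Zt%:R) * k%:R ^+ 2 <= rho * A ^+ k.
  by rewrite -thetaE; exact: dom1.
have domk2 : 8 * Z / c * (ln A + ln (16 / c) + 1) * k%:R ^+ 2 <= rho * A ^+ k.
  by rewrite -thetaE; exact: dom2.
have domk3 : K%:R / c * k%:R ^+ 2 <= A ^+ k by exact: dom3.
have bin_rho : rho * 'C(t, k)%:R <= 'C(z, k)%:R.
  have := bin_ratio t z k; rewrite -(ler_nat R) !natrM !natrX.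
  have -> : (z - k)%N%:R = alpha * t%:R :> R.
    rewrite tR /alpha /z -{2}[k]mul1n -mulnBl natrM natrB.
      by field; rewrite gt_eqF.
    by rewrite -(ltr0n R) YtE; lra.
  by rewrite exprMn mulrA ler_pM2r ?exprn_gt0 // mulrC.
have k_le_t : (k <= t)%N.
  by rewrite leq_pmull // -(ltr0n R).
have beta_le : beta <= rho * (c / 4) - lambda * (4 * tau0 / c) - t%:R * expR (- lambda).
  have le1 : lambda * (4 * tau0 / c) <= ln A * D * k%:R ^+ 2 / A ^+ k.
    have -> : lambda * (4 * tau0 / c) = ln A * D * k%:R ^+ 2 / q%:R.
      by rewrite /lambda /tau0 /D tR; field; rewrite !gt_eqF.
    have ge0 : 0 <= ln A * D * k%:R ^+ 2.
      exact: mulr_ge0 (mulr_ge0 (ltW lnA0) (ltW D0)) (exprn_ge0 2 (ler0n R k)).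
    by rewrite ler_wpM2l // lef_pV2 ?posrE.
  have le2 : t%:R * expR (- lambda) <= Zt%:R * k%:R ^+ 2 / A ^+ k.
    by rewrite expA tR ler_wpM2r ?invr_ge0 ?(ltW Ak0) // ler_wpM2l // ltW.
  have le3 : 8 / c * ((ln A * D + Zt%:R) * k%:R ^+ 2 / A ^+ k) <= rho.
    by rewrite mulrA mulrA ler_pdivrMr.
  have := ler_wpM2l (ltW c0) le3.
  have -> : c * (8 / c * ((ln A * D + Zt%:R) * k%:R ^+ 2 / A ^+ k)) =
    8 * (ln A * D * k%:R ^+ 2 / A ^+ k + Zt%:R * k%:R ^+ 2 / A ^+ k).
    by field; rewrite !gt_eqF.
  by rewrite /beta; lra.
have tail : expR (- beta) ^+ w0 < 1 - expR (- beta).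
  have beta1 : beta <= 1.
    have : rho * (c / 4) <= 1 * (c / 4) by rewrite ler_wpM2r // divr_ge0 // ltW.
    by rewrite /beta; lra.
  have half : beta / 2 <= 1 - expR (- beta).
    have le : expR (- beta) <= (1 + beta)^-1.
      rewrite expRN lef_pV2 ?posrE ?expR_gt0 ?expR_ge1Dx //; lra.
    have -> : beta / 2 = 1 - (1 - beta / 2) by lra.
    rewrite lerB // (le_trans le) // -[(1 + beta)^-1]mul1r ler_pdivrMr; last by lra.
    have := mulr_ge0 (ltW beta0) (_ : 0 <= 1 - beta); rewrite subr_ge0 => /(_ beta1).
    lra.
  apply: lt_le_trans half.
  (* [beta / 2] equals [rho * c / 16], and [rho] is at least [A ^ -k] because [alpha] exceeds
     [A^-1]. *)
  have lower : expR (- (lambda + ln (16 / c))) <= beta / 2.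
    rewrite opprD expRD expA expRN lnK ?posrE ?divr_gt0 // invf_div.
    have : (A ^+ k)^-1 <= rho.
      by rewrite -exprVn lerXn2r ?nnegrE // ltW.
    move=> /(ler_wpM2r (ltW c0)); rewrite /beta; lra.
  apply: lt_le_trans lower; rewrite -expRM_natr ltr_expR mulNr ltrN2.
  apply: (@lt_le_trans _ _ (beta * (A ^+ k / Z))); last first.
    by rewrite ler_wpM2l ?(ltW beta0) // ler_pdivrMr // mulrC.
  have -> : beta * (A ^+ k / Z) = c / (8 * Z) * (rho * A ^+ k).
    by rewrite /beta; field; rewrite !gt_eqF.
  have cZ0 : 0 <= c / (8 * Z) by rewrite ltW // divr_gt0 ?mulr_gt0.
  apply: lt_le_trans (ler_wpM2l cZ0 domk2).
  have -> : c / (8 * Z) * (8 * Z / c * (ln A + ln (16 / c) + 1) * k%:R ^+ 2) =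
    (ln A + ln (16 / c) + 1) * k%:R ^+ 2 by field; rewrite !gt_eqF.
  have := ler_wpM2l (ltW lnA0) k2R; have := ler_wpM2l (ltW ln16) (le_trans kR k2R).
  by rewrite /lambda; move: (ln (16 / c)) => L; lra.
apply: (not_choosable_of_containers sys bin_rho (ltW rho0) rho1 k_le_t beta_le
  beta0 lambda0 tail) => I.
pose T j := I j :&: sel (I j).
pose X := [set v | (z <= #|missing excl T v|)%N].
pose a v := (\sum_(j < t) (v \in T j))%N.
have heavy : c * (\sum_v b v)%N%:R <= (\sum_(v in X) b v)%N%:R.
  have := heavy_missing R z I sys _ _ den0.
  rewrite -!(ltr0n R) => /(_ t0 q0).
  rewrite [X in _ -> _ <= X%:R](eq_bigl (fun v => (z <= #|missing excl T v|)%N)).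
    apply: le_trans; rewrite ler_wpM2r //.
    have -> : z%:R / t%:R = Yt%:R / Zt%:R :> R.
      by rewrite tR natrM; field; rewrite !gt_eqF // ltr0n.
    suff : K%:R / q%:R <= c by lra.
    rewrite ler_pdivrMr // mulrC -ler_pdivrMr //.
    have : K%:R / c <= K%:R / c * k%:R ^+ 2.
      by rewrite ler_peMr ?divr_ge0 ?(ltW c0) //; lra.
    by move=> /le_trans/(_ domk3)/le_trans; apply.
  by move=> v; rewrite inE.
have light : (\sum_v a v * b v)%N%:R <= tau0 * (\sum_v b v)%N%:R.
  have -> : (\sum_v a v * b v = \sum_j \sum_(v in T j) b v)%N.
    rewrite (exchange_big_dep xpredT) //=; apply: eq_bigr => v _.
    rewrite big_distrl /= [RHS]big_mkcond /=; apply: eq_bigr => j _.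
    by case: (v \in T j); rewrite ?mul1n ?mul0n.
  rewrite natr_sum /tau0 -!mulrA.
  have -> (x : R) : t%:R * x = \sum_(j < t) x by rewrite sumr_const card_ord mulr_natl.
  apply: ler_sum => j _; rewrite mulrCA ler_pdivlMl //.
  apply: (@le_trans _ _ (K%:R * (\sum_v b v)%N%:R)).
    rewrite -!natrM ler_nat; exact: fingerprint_small sys _.
  by rewrite ler_wpM2r // lerDl.
have [w [lew_ heavyw lightw]] := find X a tau0 tau00 heavy light.
exists w; split=> //.
  apply: le_trans heavyw _; rewrite ler_nat subset_leq_card //.
  by apply/subsetP => v; rewrite !inE => /andP[-> ->].
apply: le_trans lightw; rewrite ler_nat /a exchange_big leq_sum // => j _.
rewrite -sum1_card big_mkcond [leqRHS]big_mkcond leq_sum // => v _.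
by rewrite in_setI -/(T j); case: (v \in initial w); case: (v \in T j).
Qed.

(** * Lower bounds on the choice number *)

Lemma natr_subn_ge (R : realDomainType) (x y : nat) : x%:R - y%:R <= (x - y)%N%:R :> R.
Proof.
have [le|/ltnW le] := leqP y x; first by rewrite natrB.
by rewrite (eqP (le : (x - y)%N == 0%N)) subr_le0 ler_nat.
Qed.

Lemma average_degreeE (R : realType) (T : finType) (E : {set {set T}}) r :
  uniform_hypergraph r E -> average_degree R E = r%:R * #|E|%:R / #|T|%:R.
Proof. by move=> uE; rewrite /average_degree (sum_degree uE) natrM. Qed.

(** Pass to a subhypergraph of minimum degree at least [#|E| / #|T|], order it by decreasing degree
    and take [q] about [A ^ k]. *)
Lemma not_choosable (R : realType) (s : nat) (A : R) :
  (s.+2 ^ s.+1)%:R < A -> exists (C : R) (k0 : nat), forall k, (k0 <= k)%N ->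
  forall (T : finType) (E : {set {set T}}),
    uniform_hypergraph s.+2 E -> linear_edges E ->
    C * A ^+ (k * s.+1) <= average_degree R E -> ~ choosable E k.
Proof.
move=> ltA; set M := (s.+2 ^ s.+1)%N in ltA.
have M1 : (0 < M)%N by rewrite expn_gt0.
have MR : 1 <= M%:R :> R by rewrite ler1n.
have A1 : 1 < A by apply: le_lt_trans ltA.
have A0 : 0 < A by lra.
have M0 : 0 < M%:R :> R by lra.
have gap : 0 < M%:R^-1 - A^-1 by rewrite subr_gt0 ltf_pV2.
pose m := (Num.truncn (2 / (M%:R^-1 - A^-1))).+1.
have mR : 0 < m%:R :> R by rewrite ltr0n.
have lt_m : 2 / m%:R < M%:R^-1 - A^-1.
  by rewrite ltr_pdivrMr // mulrC -ltr_pdivrMr //; apply: truncnS_gt.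
pose num := (m * m - m.+1 * M)%N; pose den := (m.+1 * M * m)%N.
have den0 : (0 < den)%N by rewrite !muln_gt0 M1.
have num_le : (num <= den)%N.
  apply: leq_trans (leq_subr _ _) _; rewrite leq_mul2r; apply/orP; right.
  by apply: leq_trans (leqnSn m) _; rewrite leq_pmulr.
have ratio : A^-1 < num%:R / den%:R.
  apply: (@lt_le_trans _ _ ((m%:R * m%:R - m.+1%:R * M%:R) / den%:R)); last first.
    by rewrite ler_wpM2r ?invr_ge0 // -!natrM natr_subn_ge.
  have -> : (m%:R * m%:R - m.+1%:R * M%:R) / den%:R =
      M%:R^-1 - (m.+1%:R * M%:R)^-1 - m%:R^-1 :> R.
    rewrite /den !natrM -natr1; field; rewrite !gt_eqF //=; lra.
  have : (m.+1%:R * M%:R)^-1 <= m%:R^-1 :> R.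
    rewrite lef_pV2 ?posrE ?mulr_gt0 ?ltr0n // -natrM ler_nat.
    by apply: leq_trans (leqnSn m) _; rewrite leq_pmulr.
  move: lt_m; move: (m%:R^-1 : R) (M%:R^-1 : R) ((_ * _)^-1) A^-1 => u v x a; lra.
have [c c0 asym] := asymptotic_not_choosable den0 num_le A1 ratio.
have [k0 notch] := asym (s.+1 * m)%N (16 / c) (divr_gt0 (ltr0n _ 16) c0).
(* The summands ensure in turn the minimum degree [m * Q], a loss of at most a factor 2 in
   truncating [w0], and [A ^ k <= D]. *)
pose C0 : R := m%:R * 2 ^+ s.+1 + 16 / c + 1.
have C0_ge : [/\ 0 < C0, m%:R * 2 ^+ s.+1 <= C0, 16 / c <= C0 & 1 <= C0].
  have : 0 <= m%:R * 2 ^+ s.+1 :> R by rewrite mulr_ge0 ?exprn_ge0.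
  have : 0 < 16 / c by rewrite divr_gt0.
  rewrite /C0; move: (m%:R * _) (16 / c) => x y y0 x0; split; lra.
case: C0_ge => C00 C0m C0c C01.
exists (s.+2%:R * C0), k0 => k lek T E uE linE le_avg chE.
have cE e : e \in E -> (1 < #|e|)%N by move/uE ->.
have Aks : 1 <= A ^+ (k * s.+1) by rewrite exprn_ege1 // ltW.
have T0 : (0 < #|T|)%N.
  rewrite lt0n; apply/negP => /eqP T0; move: le_avg.
  rewrite (average_degreeE _ uE) T0 invr0 mulr0 leNgt mulr_gt0 ?mulr_gt0 ?ltr0n //.
  lra.
pose D : R := #|E|%:R / #|T|%:R.
have DE : C0 * A ^+ (k * s.+1) <= D.
  move: le_avg; rewrite (average_degreeE _ uE) -!mulrA ler_pM2l ?ltr0n //.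
have D0 : 0 < D by apply: lt_le_trans DE; rewrite mulr_gt0 //; lra.
have E0 : (0 < #|E|)%N.
  by rewrite -(ltr0n R); move: D0; rewrite /D pmulr_lgt0 // invr_gt0 ltr0n.
have [W W0 degW] := min_degree_subgraph cE E0.
have [f [f_inj fW f_mono]] := sorted_enumeration W (degree (induced E W)).
pose E' := pullback f E.
have uE' : uniform_hypergraph s.+2 E' := pullback_uniform f_inj uE.
have linE' : linear_edges E' := pullback_linear f_inj linE.
have cE' e : e \in E' -> (1 < #|e|)%N by move/uE' ->.
have degE' i : degree E' i = degree (induced E W) (f i).
  by rewrite /E' pullback_degree // fW.
have degD i : D <= (degree E' i)%:R.
  rewrite /D ler_pdivrMr ?ltr0n // -natrM ler_nat mulnC degE' ltnW // degW //.
  by rewrite -fW imset_f.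
have degn i : (degree E' i <= #|W|)%N.
  by rewrite -[leqRHS]card_ord degree_le.
pose q := (Num.truncn (A ^+ k)).+1.
have leq_ : A ^+ k <= q%:R by apply/ltW/truncnS_gt.
have qle : q%:R <= 2 * A ^+ k.
  have Ak1 : 1 <= A ^+ k by rewrite exprn_ege1 // ltW.
  have : (Num.truncn (A ^+ k))%:R <= A ^+ k by rewrite truncn_le //; lra.
  by rewrite /q -natr1; lra.
pose Q := (q ^ s.+1)%N.
have Q0 : (0 < Q)%N by rewrite expn_gt0.
have mQ : m%:R * Q%:R <= D.
  apply: le_trans DE; apply: (@le_trans _ _ (m%:R * 2 ^+ s.+1 * A ^+ (k * s.+1))).
    rewrite -mulrA ler_wpM2l // natrX exprM -exprMn lerXn2r ?nnegrE ?mulr_ge0 //.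
    by rewrite exprn_ge0 // ltW.
  by rewrite ler_wpM2r //; lra.
have mindeg i : (m * Q <= degree E' i)%N.
  by rewrite -(ler_nat R) natrM (le_trans mQ).
pose b i := (degree E' i %/ Q + 1)%N.
have b_mono (i j : 'I_#|W|) : (i <= j)%N -> (b j <= b i)%N.
  by move=> le; rewrite leq_add2r leq_div2r // !degE' f_mono.
(* Degrees are at most the number of vertices and at least [D], so the first [c * D / 8] vertices
   carry at most a quarter of the proportion [c] of the weight. *)
pose w0 := Num.truncn (c * D / 8).
have cD0 : 0 <= c * D / 8 by rewrite divr_ge0 // mulr_ge0 // ltW.
have w0_le : w0%:R <= c * D / 8 by rewrite truncn_le.
have sys := min_degree_containers w0 (ltn0Sn _ : (0 < q)%N) uE' linE' mindeg.
have B0 : (0 < \sum_v b v)%N by rewrite (bigD1 (Ordinal W0)) //= /b addn1.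
apply: (notch k lek _ E' _ w0 q _ _ sys) => //.
- have D_ge : A ^+ k <= D.
    apply: le_trans DE; apply: (@le_trans _ _ (A ^+ (k * s.+1))).
      by apply: ler_weXn2l; [exact: ltW | rewrite leq_pmulr].
    by rewrite ler_peMl //; lra.
  have cD16 : 16 <= c * D.
    have : 16 / c <= D.
      by apply: le_trans C0c (le_trans _ DE); rewrite ler_peMr // ltW.
    by rewrite ler_pdivrMr // mulrC.
  have lt : c * D / 8 < w0%:R + 1 by rewrite natr1 truncnS_gt.
  rewrite mulrAC ler_pdivlMr //; have := ler_wpM2r (ltW c0) D_ge; lra.
- move=> X a tau tau0 heavy light.
  apply: (exists_balanced_prefix (b := b)) => //.
  set B := (\sum_v b v)%N.
  have QB : #|W|%:R * D <= Q%:R * B%:R.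
    apply: (@le_trans _ _ (\sum_v degree E' v)%N%:R).
      rewrite natr_sum -[in leLHS](card_ord #|W|) mulr_natl -sumr_const.
      exact: ler_sum.
    rewrite -natrM ler_nat big_distrr; apply: leq_sum => i _ /=.
    by rewrite /b mulnDr muln1 mulnC {1}(divn_eq (degree E' i) Q) leq_add2l ltnW ?ltn_mod.
  have QS : Q%:R * (\sum_(v in initial w0) b v)%N%:R <= w0%:R * (2 * #|W|%:R) :> R.
    rewrite -!natrM ler_nat; apply: leq_trans (_ : \sum_(v in @initial #|W| w0) 2 * #|W| <= _)%N.
      rewrite big_distrr; apply: leq_sum => i _ /=.
      rewrite /b mulnDr muln1 mulnC mul2n -addnn leq_add //.
        exact: leq_trans (leq_trunc_div _ _) (degn i).
      apply: leq_trans (degn i); apply: leq_trans (mindeg i).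
      by rewrite leq_pmull.
    rewrite sum_nat_const leq_mul2r; apply/orP; right.
    have [le|/ltnW le] := leqP w0 #|W|; first by rewrite card_initial.
    by apply: leq_trans le; rewrite -[leqRHS]card_ord max_card.
  rewrite -(ler_pM2l (_ : 0 < Q%:R :> R)) ?ltr0n //.
  have WR : 0 <= #|W|%:R :> R by [].
  have := ler_wpM2r WR w0_le; have := ler_wpM2l (ltW c0) QB; lra.
by apply: choosable_pullback chE; rewrite ?card_ord.
Qed.

(** The weight is constant, so the whole vertex set serves as the prefix. The constant [2 ^ s.+1]
    absorbs the rounding in [q <= 2 * A ^ k]. *)
Lemma regular_not_choosable (R : realType) (s : nat) (A : R) :
  s.+2%:R < A -> exists (C : R) (k0 : nat), forall k, (k0 <= k)%N ->
  forall (T : finType) (E : {set {set T}}),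
    uniform_hypergraph s.+2 E -> linear_edges E -> regular_hypergraph E ->
    C * A ^+ (k * s.+1) <= average_degree R E -> ~ choosable E k.
Proof.
move=> ltA; set M := (4 * s.+2 ^ s.+1)%N.
have r1 : 1 < s.+2%:R :> R by rewrite ltr1n.
have r0 : 0 < s.+2%:R :> R by lra.
have A1 : 1 < A by lra.
have A0 : 0 < A by lra.
have gap : 0 < 1 - s.+2%:R / A by rewrite subr_gt0 ltr_pdivrMr // mul1r.
pose m := (Num.truncn (M%:R / (1 - s.+2%:R / A))).+1.
have mR : 0 < m%:R :> R by rewrite ltr0n.
have lt_m : M%:R / m%:R < 1 - s.+2%:R / A.
  by rewrite ltr_pdivrMr // mulrC -ltr_pdivrMr //; apply: truncnS_gt.
pose num := (m - M)%N; pose den := (s.+2 * m)%N.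
have num_le : (num <= den)%N by apply: leq_trans (leq_subr _ _) (leq_pmull _ _).
have ratio : A^-1 < num%:R / den%:R.
  apply: (@lt_le_trans _ _ ((m%:R - M%:R) / den%:R)); last first.
    by rewrite ler_wpM2r ?invr_ge0 // natr_subn_ge.
  have -> : (m%:R - M%:R) / den%:R = (1 - M%:R / m%:R) / s.+2%:R :> R.
    by rewrite /den !natrM; field; rewrite -natrD !pnatr_eq0.
  rewrite ltr_pdivlMr // mulrC; move: lt_m; move: (_ / m%:R) (_ / A) => x y; lra.
have [c c0 asym] := asymptotic_not_choosable (isT : (0 < den)%N) num_le A1 ratio.
have [k0 notch] := asym (m * (s.+1 * m))%N 1 ltr01.
exists (2 ^+ s.+1), k0 => k lek T E uE linE regE le_avg chE.
have cE e : e \in E -> (1 < #|e|)%N by move/uE ->.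
have Aks : 1 <= A ^+ (k * s.+1) by rewrite exprn_ege1 // ltW.
have two1 : 1 <= 2 ^+ s.+1 :> R by rewrite exprn_ege1 // ler1n.
have T0 : (0 < #|T|)%N.
  rewrite lt0n; apply/negP => /eqP T0; move: le_avg.
  rewrite /average_degree T0 invr0 mulr0 leNgt mulr_gt0 //; lra.
have [x0 _] : exists x : T, x \in T by exact/card_gt0P.
pose d := degree E x0.
have avgE : average_degree R E = d%:R.
  rewrite /average_degree (eq_bigr (fun=> d)) => [|x _]; last exact: regE.
  by rewrite sum_nat_const natrM mulrAC divff ?mul1r // pnatr_eq0 -lt0n.
rewrite avgE in le_avg.
have [f [f_inj fT _]] := sorted_enumeration [set: T] (fun=> 0%N).
set n := #|[set: T]| in f f_inj fT *.
have n0 : (0 < n)%N by rewrite /n cardsT.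
pose E' := pullback f E.
have uE' : uniform_hypergraph s.+2 E' := pullback_uniform f_inj uE.
have linE' : linear_edges E' := pullback_linear f_inj linE.
have cE' e : e \in E' -> (1 < #|e|)%N by move/uE' ->.
have degE' i : degree E' i = d.
  rewrite /E' pullback_degree // fT.
  have -> : induced E setT = E by apply/setP => e; rewrite inE subsetT andbT.
  exact: regE.
pose q := (Num.truncn (A ^+ k)).+1.
have leq_ : A ^+ k <= q%:R by apply/ltW/truncnS_gt.
have qle : q%:R <= 2 * A ^+ k.
  have Ak1 : 1 <= A ^+ k by rewrite exprn_ege1 // ltW.
  have : (Num.truncn (A ^+ k))%:R <= A ^+ k by rewrite truncn_le //; lra.
  by rewrite /q -natr1; lra.
have Qd : (q ^ s.+1 <= d)%N.
  rewrite -(ler_nat R) natrX; apply: le_trans le_avg.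
  rewrite exprM -exprMn lerXn2r ?nnegrE ?mulr_ge0 //.
  by rewrite exprn_ge0 // ltW.
have sys := regular_containers (ltn0Sn _ : (0 < q)%N) (ltn0Sn _ : (0 < m)%N)
  uE' linE' degE' Qd.
set b0 := (d %/ q ^ s.+1 + 1)%N in sys.
have b00 : 0 < b0%:R :> R by rewrite ltr0n /b0 addn1.
have nR : 0 < n%:R :> R by rewrite ltr0n.
apply: (notch k lek _ E' _ n q _ _ sys) => //.
- by rewrite sum_nat_const card_ord muln_gt0 n0 /b0 addn1.
- rewrite mul1r; apply: (@le_trans _ _ (A ^+ (k * s.+1))).
    by apply: ler_weXn2l; [exact: ltW | rewrite leq_pmulr].
  apply: (@le_trans _ _ d%:R).
    by apply: le_trans le_avg; rewrite ler_peMl //; lra.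
  by rewrite ler_nat -(degE' (Ordinal n0)) -[leqRHS]card_ord degree_le.
- move=> X a tau tau0; rewrite !sum_nat_const card_ord -big_distrl !natrM /=.
  rewrite !mulrA !ler_pM2r // => heavy light.
  have c1 : c <= 1.
    rewrite -(ler_pM2r nR) mul1r (le_trans heavy) // ler_nat.
    by rewrite -[leqRHS](card_ord n) max_card.
  exists n; rewrite initial_full setIT leqnn; split=> //.
    apply: le_trans heavy; rewrite ler_wpM2r //; lra.
  rewrite (eq_bigl xpredT) => [|v]; last by rewrite inE.
  apply: le_trans light _; rewrite ler_wpM2r // ler_pdivlMr //.
  by rewrite mulrC ler_wpM2r //; lra.
by apply: choosable_pullback chE; rewrite ?card_ord.
Qed.

(** * From choosability to the list chromatic number *)

Lemma choosable_leq (T : finType) (E : {set {set T}}) (k k' : nat) :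
  (k <= k')%N -> choosable E k -> choosable E k'.
Proof.
move=> lekk' chE C L cardL.
pose L' v : {fset C} := [fset x in take k (L v : seq C)]%fset.
have cardL' v : #|` L' v| = k.
  rewrite /L' card_fseq undup_id ?take_uniq ?fset_uniq // size_take -[size _]/#|` L v|.
  by rewrite cardL; case: ltngtP lekk'.
have [c [cL nmono]] := chE C L' cardL'.
by exists c; split=> // v; have := cL v; rewrite inE => /mem_take.
Qed.

(** Lists this long allow a greedy choice of pairwise distinct colours. *)
Lemma choosable_card (T : finType) (E : {set {set T}}) :
  (forall e, e \in E -> (1 < #|e|)%N) -> choosable E #|T|.
Proof.
move=> cE C L cardL.
have fresh v (s : seq C) : (size s < #|T|)%N -> exists2 x, x \in L v & x \notin s.
  move=> lts; apply/allPn; apply/negP => /allP sub.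
  have := uniq_leq_size (fset_uniq (L v)) sub.
  by rewrite -[size (L v)]/#|` L v| cardL leqNgt lts.
suff /(_ (enum T)) [||c [cL c_inj]] : forall s : seq T, uniq s -> (size s <= #|T|)%N ->
    exists c : T -> C, (forall v, c v \in L v) /\ {in s &, injective c}.
- exact: enum_uniq.
- by rewrite -cardE.
- exists c; split=> // e /cE /card_gt1P[x [y [xe ye xy]]] mono.
  by case/eqP: xy; apply: c_inj; rewrite ?mem_enum //; apply: mono.
elim=> [_ _|v s IH /= /andP[vs us] lts].
  have ex v : exists x, x \in L v.
    have [|x xL _] := fresh v [::]; last by exists x.
    by apply/card_gt0P; exists v.
  by exists (fun v => xchoose (ex v)); split=> // v; apply: xchooseP.
have [c [cL c_inj]] := IH us (ltnW lts).
have [|x xL xs] := fresh v [seq c u | u <- s]; first by rewrite size_map.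
exists (fun u => if u == v then x else c u); split=> [u|u u'].
  by case: eqP => [->|_].
have neq w : w \in s -> x != c w.
  by move=> ws; apply: contraNneq xs => ->; apply: map_f.
rewrite !inE; case: (eqVneq u v) => [-> _|_ /= us']; case: (eqVneq u' v) => [-> //|_ /= us''].
- by move/eqP; rewrite (negbTE (neq _ us'')).
- by move=> _ /esym/eqP; rewrite (negbTE (neq _ us')).
- exact: c_inj.
Qed.

From mathcomp Require Import all_classical all_reals all_analysis.

Import numFieldNormedType.Exports.
Local Open Scope classical_set_scope.
Local Open Scope ring_scope.

Lemma choosable_list_chromatic_number (T : finType) (E : {set {set T}}) :
  (forall e, e \in E -> (1 < #|e|)%N) -> choosable E (list_chromatic_number E).
Proof.
move=> cE; rewrite /list_chromatic_number.
suff ex : exists k, choosable E k /\ forall j, choosable E j -> (k <= j)%N.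
  by case: xgetP => [_ _ [] //|/(_ _)]; case: ex => k kP /(_ k).
have exb : exists k, `[< choosable E k >].
  by exists #|T|; apply/asboolP/choosable_card.
exists (ex_minn exb); case: ex_minnP => k /asboolP chk min; split=> // j chj.
exact/min/asboolP.
Qed.

(** Taking [A = A0 ^ (1 + e)] gives [ln d < ln C' + k p (1 + e) ln A0]. For large [d] the constant
    is at most [e^2 ln d], and [1 - e^2] factors as [(1 - e) (1 + e)]. *)
Lemma list_chromatic_lower_bound (R : realType) (r p : nat) (A0 : R)
    (class : forall T : finType, {set {set T}} -> Prop) :
  (2 <= r)%N -> (0 < p)%N -> 1 < A0 ->
  (forall T E, class T E -> uniform_hypergraph r E) ->
  (forall A, A0 < A -> exists (C : R) (k0 : nat), forall k, (k0 <= k)%N ->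
    forall (T : finType) (E : {set {set T}}), class T E ->
    C * A ^+ (k * p) <= average_degree R E -> ~ choosable E k) ->
  forall e : R, 0 < e -> exists D : R, forall (T : finType) (E : {set {set T}}),
    class T E -> D <= average_degree R E ->
    (1 - e) * ln (average_degree R E) / (p%:R * ln A0) <=
      (list_chromatic_number E)%:R.
Proof.
move=> r2 p0 A01 unif notch e e0.
have lnA0 : 0 < ln A0 by rewrite ln_gt0.
have A00 : 0 < A0 by apply: lt_trans A01.
pose A := expR ((1 + e) * ln A0).
have ltA : A0 < A.
  by rewrite -{1}(@lnK _ A0) ?posrE // ltr_expR mulrDl mul1r ltrDl mulr_gt0.
have [C [k0 no]] := notch A ltA.
pose C' := Num.max C 1.
have C'0 : 0 < C' by rewrite lt_max ltr01 orbT.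
(* The first bound forces the list chromatic number up to [k0]; the second absorbs [ln C']. *)
exists (Num.max (C' * A ^+ (k0 * p)) (expR (ln C' / e ^+ 2))) => T E cl.
set d := average_degree R E; rewrite ge_max => /andP[le1 le2].
have d0 : 0 < d by apply: lt_le_trans le2; apply: expR_gt0.
have A_gt0 : 0 < A by apply: expR_gt0.
set k := list_chromatic_number E.
have chk : choosable E k.
  by apply: choosable_list_chromatic_number => f /(unif _ _ cl) ->.
have Apos j : 0 < A ^+ j by rewrite exprn_gt0.
have lekk : (k0 <= k)%N.
  rewrite leqNgt; apply/negP => /ltnW /choosable_leq/(_ chk).
  apply: (no k0 (leqnn _) T E cl); apply: le_trans le1.
  by rewrite ler_wpM2r ?(ltW (Apos _)) // le_max lexx.
have ltd : d < C' * A ^+ (k * p).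
  rewrite ltNge; apply/negP => led; apply: (no k lekk T E cl _ chk).
  by apply: le_trans led; rewrite ler_wpM2r ?(ltW (Apos _)) // le_max lexx.
have lnd : ln d < ln C' + k%:R * p%:R * ((1 + e) * ln A0).
  have -> : k%:R * p%:R * ((1 + e) * ln A0) = ln (A ^+ (k * p)).
    by rewrite lnXn // /A expRK -[RHS]mulr_natr natrM mulrC.
  by rewrite -lnM ?posrE ?Apos // ltr_ln ?posrE // mulr_gt0 ?Apos.
have lnC : ln C' <= e ^+ 2 * ln d.
  move: le2; rewrite -{1}(@lnK _ d) ?posrE // ler_expR ler_pdivrMr ?exprn_gt0 //.
  by rewrite mulrC.
rewrite ler_pdivrMr ?mulr_gt0 ?ltr0n //.
have e1 : 0 < 1 + e by rewrite addr_gt0.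
rewrite -(ler_pM2r e1).
have -> : (1 - e) * ln d * (1 + e) = ln d - e ^+ 2 * ln d by ring.
have -> : k%:R * (p%:R * ln A0) * (1 + e) = k%:R * p%:R * ((1 + e) * ln A0).
  by ring.
by rewrite lerBlDr ltW // (lt_le_trans lnd) // addrC lerD2l.
Qed.

(** Diagonal choice of the error: [level x] is the largest [m] up to [x] whose bound [D m] has been
    passed. An empty maximum is 0, giving error 1, where [Q] always holds. *)
Lemma exists_little_o (R : realType) (Q : R -> R -> Prop) : (forall x, Q x 1) ->
  (forall e, 0 < e -> exists D, forall x, D <= x -> Q x e) ->
  exists2 o : R -> R, o x @[x --> +oo] --> (0 : R) & forall x, Q x (- o x).
Proof.
move=> Q1 Qe.
have /choice[D DP] (m : nat) : exists D, forall x, D <= x -> Q x m.+1%:R^-1.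
  by apply: Qe; rewrite invr_gt0 ltr0n.
pose level (x : R) := (\max_(m < (Num.truncn x).+1 | (D m <= x)%R) m)%N.
exists (fun x => - (level x).+1%:R^-1) => [|x]; last first.
  rewrite opprK; suff [->|le] : level x = 0%N \/ D (level x) <= x.
  - by rewrite invr1.
  - exact: DP.
  rewrite /level; elim/big_ind: _ => [|m n|m lem]; [by left| |by right].
  by rewrite /maxn; case: ifP.
apply/cvgrPdist_lt => e e0; near=> x.
have lt_e : (Num.truncn e^-1).+1%:R^-1 < e.
  by rewrite invf_plt ?posrE ?ltr0n // truncnS_gt.
rewrite sub0r normrN normrN ger0_norm ?invr_ge0 //.
apply: le_lt_trans lt_e; rewrite lef_pV2 ?posrE ?ltr0n // ler_nat ltnS.
set m := Num.truncn e^-1.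
have mx : m%:R <= x by near: x; apply: nbhs_pinfty_ge; rewrite num_real.
have Dx : D m <= x by near: x; apply: nbhs_pinfty_ge; rewrite num_real.
have ltm : (m < (Num.truncn x).+1)%N by rewrite ltnS truncn_ge_nat // (le_trans _ mx).
exact: (leq_bigmax_cond (Ordinal ltm)).
Unshelve. all: by end_near.
Qed.

Lemma list_chromatic_asymptotics (R : realType) (r p : nat) (A0 kappa : R)
    (class : forall T : finType, {set {set T}} -> Prop) :
  (2 <= r)%N -> (0 < p)%N -> 1 < A0 ->
  kappa / ln r%:R = (p%:R * ln A0)^-1 ->
  (forall T E, class T E -> uniform_hypergraph r E) ->
  (forall A, A0 < A -> exists (C : R) (k0 : nat), forall k, (k0 <= k)%N ->
    forall (T : finType) (E : {set {set T}}), class T E ->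
    C * A ^+ (k * p) <= average_degree R E -> ~ choosable E k) ->
  exists o : R -> R, o x @[x --> +oo] --> (0 : R) /\
    forall (T : finType) (E : {set {set T}}), class T E ->
      (1 + o (average_degree R E)) * kappa * log_base r (average_degree R E) <=
        (list_chromatic_number E)%:R.
Proof.
move=> r2 p0 A01 kappaE unif notch.
pose Q (x e : R) := forall (T : finType) (E : {set {set T}}), class T E ->
  average_degree R E = x ->
  (1 - e) * kappa * log_base r x <= (list_chromatic_number E)%:R.
have [x T E _ _|e e0|o o0 oQ] := @exists_little_o R Q.
- by rewrite subrr !mul0r.
- have [D DP] := list_chromatic_lower_bound r2 p0 A01 unif notch e0.
  exists D => x leD T E cl avgE; rewrite -avgE in leD *.
  apply: le_trans (DP T E cl leD); rewrite -kappaE /log_base.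
  by rewrite le_eqVlt; apply/orP; left; apply/eqP; rewrite !mulrA; ring.
- by exists o; split=> // T E cl; have := oQ _ T E cl erefl; rewrite opprK.
Qed.

Theorem theorem2p1 (R : realType) (r : nat) (hr : (2 <= r)%N) :
  (exists o : R -> R,
     o x @[x --> +oo] --> (0 : R) /\
     forall (T : finType) (E : {set {set T}}),
       uniform_hypergraph r E -> simple_hypergraph E ->
       (list_chromatic_number E)%:R >=
         (1 + o (average_degree R E)) * (1 / (r%:R - 1) ^+ 2) *
           log_base r (average_degree R E)) /\
  (exists o : R -> R,
     o x @[x --> +oo] --> (0 : R) /\
     forall (T : finType) (E : {set {set T}}),
       uniform_hypergraph r E -> simple_hypergraph E -> regular_hypergraph E ->
       (list_chromatic_number E)%:R >=
         (1 + o (average_degree R E)) * (1 / (r%:R - 1)) *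
           log_base r (average_degree R E)).
Proof.
case: r hr => [|[|s]] // hr.
have r1 : 1 < s.+2%:R :> R by rewrite ltr1n.
have s1 : s.+2%:R - 1 = s.+1%:R :> R by rewrite -natr1 addrK.
rewrite s1; split.
(* With [r = s.+2], the base [r^(r-1)] and exponent [r-1] combine to [(r-1)^2 ln r]. *)
- have [ | | | |o [ o_cvg oP]] := @list_chromatic_asymptotics R s.+2 s.+1
    (s.+2 ^ s.+1)%:R (1 / s.+1%:R ^+ 2)
    (fun T E => uniform_hypergraph s.+2 E /\ simple_hypergraph E) hr isT.
  + by rewrite ltr1n -{1}(exp1n s.+1) ltn_exp2r.
  + rewrite natrX lnXn ?ltr0n // -mulr_natr.
    by rewrite div1r -invfM; congr (_^-1); ring.
  + by move=> T E [].
  + move=> A /not_choosable[C [k0 no]]; exists C, k0 => k lek T E [uE /simple_linear linE].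
    exact: no.
  by exists o; split=> // T E uE sE; apply: oP.
(* For regular hypergraphs the base is [r] itself, which saves a factor [r-1]. *)
have [ | | |o [ o_cvg oP]] := @list_chromatic_asymptotics R s.+2 s.+1
  s.+2%:R (1 / s.+1%:R)
  (fun T E => [/\ uniform_hypergraph s.+2 E, simple_hypergraph E &
     regular_hypergraph E]) hr isT r1.
- by rewrite invfM mul1r mulrC.
- by move=> T E [].
- move=> A /regular_not_choosable[C [k0 no]]; exists C, k0.
  move=> k lek T E [uE /simple_linear linE regE]; exact: no.
by exists o; split=> // T E uE sE rE; apply: oP.
Qed.
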